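(* Every nontrivial limit group is liftable-flexible.
   Context: A limit group is a finitely generated group $L$ that is fully residually free: for every finite subset $Q\subseteq L$ there is a homomorphism from $L$ to a free group which is injective on $Q$. For a group $L$, $T_L$ denotes the set of torsion elements of $L$ (including the identity). A projective representation of $L$ is a homomorphism $\rho\colon L\to \mathrm{PSL}_2(\mathbb{R})$; it is parabolic-free if $\rho(L)$ contains no nontrivial parabolic element, and indiscrete if $\rho(L)$ is not a discrete subgroup of $\mathrm{PSL}_2(\mathbb{R})$. It is liftable if it factors as $L\to \widetilde{\mathrm{PSL}}_2(\mathbb{R})\to\mathrm{PSL}_2(\mathbb{R})$ through the universal covering map. A set $\Lambda\subseteq\mathrm{Hom}(L,\mathrm{PSL}_2(\mathbb{R}))$ is tracially disjoint if $\mathrm{tr}^2\circ\rho(L\setminus T_L)\cap\mathrm{tr}^2\circ\lambda(L\setminus T_L)=\varnothing$ for every pair of distinct $\rho,\lambda\in\Lambda$, where $\mathrm{tr}^2$ is the square of the trace. A finitely generated group $L$ is liftable-flexible if there exists an uncountable, tracially disjoint set $\Lambda$ of indiscrete faithful parabolic-free liftable projective representations of $L$. *)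

(* Defs.v *)
From HB Require Import structures.
From mathcomp Require Import all_boot all_order all_algebra.
From mathcomp Require Import all_classical all_reals.
From mathcomp Require Import topology normedtype.

Set Implicit Arguments.
Unset Strict Implicit.
Unset Printing Implicit Defensive.

Import Order.TTheory GRing.Theory Num.Theory.
Import numFieldNormedType.Exports.

Local Open Scope quotient_scope.
Local Open Scope classical_set_scope.
Local Open Scope ring_scope.

Section Groups.
Local Open Scope group_scope.

Definition finitely_generated (L : groupType) : Prop :=
  exists S : seq L, forall H : groupClosed L, {subset S <= H} -> H =i predT.

(* Universal property; only the values of [f] on [X] matter. *)
Definition free_on (F : groupType) (X : set F) : Prop :=
  forall (H : groupType) (f : F -> H),
    exists phi : {multiplicative F -> H},
      (forall x, X x -> phi x = f x) /\
      (forall psi : {multiplicative F -> H},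
         (forall x, X x -> psi x = f x) -> psi =1 phi).

Definition free_group (F : groupType) : Prop := exists X : set F, free_on X.

Definition fully_residually_free (L : groupType) : Prop :=
  forall Q : set L, finite_set Q ->
    exists F : groupType, free_group F /\
    exists phi : {multiplicative L -> F}, set_inj Q phi.

Definition limit_group (L : groupType) : Prop :=
  finitely_generated L /\ fully_residually_free L.

Definition torsion (L : groupType) : set L :=
  [set x | exists n : nat, (0 < n)%N /\ x ^+ n = 1].
End Groups.

Arguments torsion : clear implicits.

Section QuotientGroup.
Local Open Scope group_scope.

Record congruence (G : groupType) := Congruence {
  congr_rel :> equiv_rel G;
  congr_mul : forall x x' y y',
    congr_rel x x' -> congr_rel y y' -> congr_rel (x * y) (x' * y')
}.

Definition quot_group (G : groupType) (e : congruence G) := {eq_quot e}.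

Variables (G : groupType) (e : congruence G).
Local Notation Q := (quot_group e).

HB.instance Definition _ := EqQuotient.on Q.
HB.instance Definition _ := Choice.on Q.

Definition qone : Q := \pi_Q 1.
Definition qmul (x y : Q) : Q := \pi_Q (repr x * repr y).
Definition qinv (x : Q) : Q := \pi_Q (repr x)^-1.

Lemma quot_eqP (x y : G) : reflect (\pi_Q x = \pi_Q y) (e x y).
Proof. exact: eqmodP. Qed.

Lemma repr_pi (x : G) : e (repr (\pi_Q x)) x.
Proof. by apply/quot_eqP; rewrite reprK. Qed.

Lemma pi_mul (x y : G) : \pi_Q (x * y) = qmul (\pi_Q x) (\pi_Q y).
Proof.
by apply/quot_eqP; rewrite equiv_sym; apply: congr_mul; exact: repr_pi.
Qed.

Lemma congr_inv (x y : G) : e x y -> e x^-1 y^-1.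
Proof.
move=> exy; have exx : e x^-1 x^-1 by apply: equiv_refl.
have eyy : e y^-1 y^-1 by apply: equiv_refl.
have := congr_mul exx (congr_mul exy eyy).
by rewrite mulgV mulg1 mulKg => eyx; rewrite equiv_sym.
Qed.

Lemma pi_inv (x : G) : \pi_Q x^-1 = qinv (\pi_Q x).
Proof.
by apply/quot_eqP; rewrite equiv_sym; apply: congr_inv; exact: repr_pi.
Qed.

Lemma qmulA : associative qmul.
Proof.
move=> x y z; rewrite -[x]reprK -[y]reprK -[z]reprK.
move: (repr x) (repr y) (repr z) => {x y z} x y z.
by rewrite -(pi_mul y z) -(pi_mul x y) -(pi_mul x) -(pi_mul _ z) mulgA.
Qed.

Lemma qmul1g : left_id qone qmul.
Proof. by move=> x; rewrite -[x]reprK -[qone]/(\pi_Q 1) -(pi_mul 1) mul1g. Qed.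

Lemma qmulg1 : right_id qone qmul.
Proof. by move=> x; rewrite -[x]reprK -[qone]/(\pi_Q 1) -(pi_mul _ 1) mulg1. Qed.

Lemma qmulVg : left_inverse qone qinv qmul.
Proof. by move=> x; rewrite -[x]reprK -(pi_inv (repr x)) -pi_mul mulVg. Qed.

Lemma qmulgV : right_inverse qone qinv qmul.
Proof. by move=> x; rewrite -[x]reprK -(pi_inv (repr x)) -pi_mul mulgV. Qed.

HB.instance Definition _ :=
  isGroup.Build Q qmulA qmul1g qmulg1 qmulVg qmulgV.

HB.instance Definition _ :=
  isMultiplicative.Build G Q (\pi_Q : G -> Q) pi_mul.

End QuotientGroup.

HB.mixin Record isTopologicalGroup G of Group G & Topological G := {
  mulg_continuous : continuous (fun x : G * G => x.1 * x.2)%g;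
  invg_continuous : continuous (fun x : G => x^-1)%g
}.

#[short(type="topologicalGroupType")]
HB.structure Definition TopologicalGroup :=
  {G of isTopologicalGroup G & Group G & Topological G}.

Section TopologicalGroupTheory.
Variables (T : topologicalType) (G : topologicalGroupType).

Lemma continuousMg (f g : T -> G) :
  continuous f -> continuous g -> continuous (fun x => f x * g x)%g.
Proof.
move=> cf cg x; apply: continuous2_cvg; [|exact: cf|exact: cg].
exact: (mulg_continuous (f x, g x)).
Qed.

Lemma continuousVg (f : T -> G) :
  continuous f -> continuous (fun x => (f x)^-1)%g.
Proof. move=> cf x; apply: continuous_comp; [exact: cf|exact: invg_continuous]. Qed.

End TopologicalGroupTheory.

Section UniversalCover.
Variables (R : realType) (G : topologicalGroupType).

Definition is_based_path (c : R -> G) : Prop :=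
  c 0 = 1%g /\ {within `[0, 1], continuous c}.

(* Only the values on [0, 1] matter; the others are identified by
   [path_homotopic] below. *)
Definition based_path := {c : R -> G | `[< is_based_path c >]}.

HB.instance Definition _ := [isSub of based_path for sval].
HB.instance Definition _ := gen_eqMixin based_path.
HB.instance Definition _ := gen_choiceMixin based_path.

Implicit Types c d : based_path.

Definition path_fun c : R -> G := val c.
Coercion path_fun : based_path >-> Funclass.

Lemma based_pathP c : is_based_path c.
Proof. by apply/asboolP; exact: (valP c). Qed.

Lemma path_ext c d : (forall t, c t = d t) -> c = d.
Proof. by move=> cd; apply: val_inj; apply/funext. Qed.

Definition mk_based_path (c : R -> G) (hc : is_based_path c) : based_path :=
  exist _ c (asboolT hc).

Lemma path_one_subproof : is_based_path (fun=> 1%g).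
Proof. by split=> // x; exact: cvg_cst. Qed.

Lemma path_mul_subproof c d : is_based_path (fun t => c t * d t)%g.
Proof.
have [c0 cc] := based_pathP c; have [d0 cd] := based_pathP d.
by split; [rewrite c0 d0 mulg1|exact: continuousMg].
Qed.

Lemma path_inv_subproof c : is_based_path (fun t => (c t)^-1)%g.
Proof.
have [c0 cc] := based_pathP c.
by split; [rewrite c0 invg1|exact: continuousVg].
Qed.

Definition bpath_one := mk_based_path path_one_subproof.
Definition bpath_mul c d := mk_based_path (path_mul_subproof c d).
Definition bpath_inv c := mk_based_path (path_inv_subproof c).

Lemma path_mulA : associative bpath_mul.
Proof. by move=> c d f; apply: path_ext => t; exact: mulgA. Qed.
Lemma path_mul1g : left_id bpath_one bpath_mul.
Proof. by move=> c; apply: path_ext => t; exact: mul1g. Qed.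
Lemma path_mulg1 : right_id bpath_one bpath_mul.
Proof. by move=> c; apply: path_ext => t; exact: mulg1. Qed.
Lemma path_mulVg : left_inverse bpath_one bpath_inv bpath_mul.
Proof. by move=> c; apply: path_ext => t; exact: mulVg. Qed.
Lemma path_mulgV : right_inverse bpath_one bpath_inv bpath_mul.
Proof. by move=> c; apply: path_ext => t; exact: mulgV. Qed.

HB.instance Definition _ := isGroup.Build based_path
  path_mulA path_mul1g path_mulg1 path_mulVg path_mulgV.

(* Homotopy relative to the endpoints: [h (s, t)] is the point at time [t] on
   the path number [s]. *)
Definition path_homotopic c d : Prop :=
  exists h : R * R -> G,
    [/\ {within `[0, 1] `*` `[0, 1], continuous h},
        forall t : R, 0 <= t <= 1 -> h (0, t) = c t,
        forall t : R, 0 <= t <= 1 -> h (1, t) = d t,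
        forall s : R, 0 <= s <= 1 -> h (s, 0) = c 0 &
        forall s : R, 0 <= s <= 1 -> h (s, 1) = c 1].

Lemma path_homotopic_end c d : path_homotopic c d -> c 1 = d 1.
Proof.
case=> h [_ _ h1 _ he].
by rewrite -(he 1) ?h1 ?ler01 ?lexx.
Qed.

Lemma continuous_path_snd c :
  {within `[0, 1] `*` `[0, 1], continuous (fun z : R * R => c z.2)}.
Proof.
have [_ cc] := based_pathP c.
apply/continuous_subspace_prodP => z _.
pose I01 := subspace `[0 : R, 1].
apply: (@continuous_comp (I01 * I01)%type I01 G snd c); first exact: cvg_snd.
exact: cc.
Qed.

Lemma path_homotopic_refl c : path_homotopic c c.
Proof.
exists (fun z => c z.2); split=> //; exact: continuous_path_snd.
Qed.

Lemma path_homotopic_mul c c' d d' :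
  path_homotopic c c' -> path_homotopic d d' ->
  path_homotopic (c * d)%g (c' * d')%g.
Proof.
move=> [h [hc h0 h1 hs ht]] [k [kc k0 k1 ks kt]].
exists (fun z => h z * k z)%g; split.
- exact: continuousMg.
- by move=> t tI; rewrite h0// k0.
- by move=> t tI; rewrite h1// k1.
- by move=> t tI; rewrite hs// ks.
- by move=> t tI; rewrite ht// kt.
Qed.

Lemma path_homotopic_inv c d :
  path_homotopic c d -> path_homotopic c^-1%g d^-1%g.
Proof.
move=> [h [hc h0 h1 hs ht]].
exists (fun z => (h z)^-1)%g; split.
- exact: continuousVg.
- by move=> t tI; rewrite h0.
- by move=> t tI; rewrite h1.
- by move=> t tI; rewrite hs.
- by move=> t tI; rewrite ht.
Qed.

Lemma path_homotopic_sym c d : path_homotopic c d -> path_homotopic d c.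
Proof.
move=> cd; have := path_homotopic_mul (path_homotopic_refl d)
  (path_homotopic_mul (path_homotopic_inv cd) (path_homotopic_refl c)).
by rewrite mulVg mulg1 mulVKg.
Qed.

Lemma path_homotopic_trans c d f :
  path_homotopic c d -> path_homotopic d f -> path_homotopic c f.
Proof.
move=> cd df; have := path_homotopic_mul cd
  (path_homotopic_mul (path_homotopic_refl d^-1%g) df).
by rewrite mulVg mulg1 mulVKg.
Qed.

Definition path_homotopicb c d : bool := `[< path_homotopic c d >].

Lemma path_homotopicb_refl : reflexive path_homotopicb.
Proof. by move=> c; apply/asboolP; exact: path_homotopic_refl. Qed.
Lemma path_homotopicb_sym : symmetric path_homotopicb.
Proof.
by move=> c d; apply/asboolP/asboolP; exact: path_homotopic_sym.
Qed.
Lemma path_homotopicb_trans : transitive path_homotopicb.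
Proof.
move=> d c f /asboolP cd /asboolP df; apply/asboolP.
exact: path_homotopic_trans cd df.
Qed.

Definition path_homotopic_equiv : equiv_rel based_path :=
  EquivRel path_homotopicb
    path_homotopicb_refl path_homotopicb_sym path_homotopicb_trans.

Lemma path_homotopicb_mul c c' d d' :
  path_homotopic_equiv c c' -> path_homotopic_equiv d d' ->
  path_homotopic_equiv (c * d)%g (c' * d')%g.
Proof.
move=> /asboolP cc' /asboolP dd'; apply/asboolP.
exact: path_homotopic_mul.
Qed.

Definition path_congruence : congruence based_path :=
  Congruence path_homotopicb_mul.

(* The standard model of the universal cover of [G] (assumed connected, locally
   path-connected and semilocally simply connected): homotopy classes of paths
   from 1, with pointwise multiplication, projecting to the endpoint. *)
Definition universal_cover := quot_group path_congruence.

HB.instance Definition _ := Group.on universal_cover.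

Definition covering_map (x : universal_cover) : G := path_fun (repr x) 1.

Lemma covering_map_pi c : covering_map (\pi c) = c 1.
Proof.
apply: path_homotopic_end; apply/asboolP.
exact: (repr_pi path_congruence c).
Qed.

Lemma covering_mapM :
  {morph covering_map : x y / (x * y)%g}.
Proof.
by move=> x y; exact: (covering_map_pi (repr x * repr y)%g).
Qed.

HB.instance Definition _ :=
  isMultiplicative.Build universal_cover G covering_map covering_mapM.

End UniversalCover.

Section SL2.
Variable R : realType.

Definition SL2 := {A : 'M[R]_2 | \det A == 1}.

HB.instance Definition _ := [isSub of SL2 for sval].
HB.instance Definition _ := [Choice of SL2 by <:].

Definition SL2_mx (A : SL2) : 'M[R]_2 := val A.
Coercion SL2_mx : SL2 >-> matrix.

HB.instance Definition _ :=
  Topological.copy SL2 (initial_topology SL2_mx).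

Implicit Types A B : SL2.

Lemma SL2_det A : \det A = 1.
Proof. exact/eqP/(valP A). Qed.

Lemma SL2_unit A : (A : 'M[R]_2) \in unitmx.
Proof. by rewrite unitmxE SL2_det unitr1. Qed.

Lemma SL2_one_subproof : \det (1%:M : 'M[R]_2) == 1.
Proof. by rewrite det1. Qed.
Lemma SL2_mul_subproof A B : \det ((A : 'M[R]_2) *m B) == 1.
Proof. by rewrite det_mulmx !SL2_det mulr1. Qed.
Lemma SL2_inv_subproof A : \det (invmx A) == 1.
Proof. by rewrite det_inv SL2_det invr1. Qed.

Definition SL2_one : SL2 := exist _ 1%:M SL2_one_subproof.
Definition SL2_mul A B : SL2 := exist _ (SL2_mx A *m SL2_mx B) (SL2_mul_subproof A B).
Definition SL2_inv A : SL2 := exist _ (invmx (SL2_mx A)) (SL2_inv_subproof A).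

Lemma SL2_mulA : associative SL2_mul.
Proof. by move=> A B C; apply: val_inj; exact: mulmxA. Qed.
Lemma SL2_mul1g : left_id SL2_one SL2_mul.
Proof. by move=> A; apply: val_inj; exact: mul1mx. Qed.
Lemma SL2_mulg1 : right_id SL2_one SL2_mul.
Proof. by move=> A; apply: val_inj; exact: mulmx1. Qed.
Lemma SL2_mulVg : left_inverse SL2_one SL2_inv SL2_mul.
Proof. by move=> A; apply: val_inj; apply: mulVmx; exact: SL2_unit. Qed.
Lemma SL2_mulgV : right_inverse SL2_one SL2_inv SL2_mul.
Proof. by move=> A; apply: val_inj; apply: mulmxV; exact: SL2_unit. Qed.

HB.instance Definition _ := isGroup.Build SL2
  SL2_mulA SL2_mul1g SL2_mulg1 SL2_mulVg SL2_mulgV.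

Lemma continuous_mx (T : topologicalType) (m n : nat) (f : T -> 'M[R]_(m, n)) :
  (forall i j, continuous (fun t => f t i j)) -> continuous f.
Proof.
move=> cf t U [P nP PU].
have : nbhs t [set s | forall i j, P i j (f s i j)].
  apply: filter_forall => i; apply: filter_forall => j.
  exact: (cf i j t _ (nP i j)).
by apply: filterS => s /PU.
Qed.

Lemma SL2_continuous (T : topologicalType) (f : T -> SL2) :
  (forall i j, continuous (fun t => (f t : 'M[R]_2) i j)) -> continuous f.
Proof. by move=> cf; apply/continuous_comp_initial/continuous_mx. Qed.

Lemma SL2_coord_continuous i j : continuous (fun A : SL2 => (A : 'M[R]_2) i j).
Proof.
move=> A; apply: (@continuous_comp _ _ _ SL2_mx (fun M : 'M[R]_2 => M i j)).
  exact: initial_continuous.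
exact: coord_continuous.
Qed.

Lemma SL2_mul_continuous : continuous (fun x : SL2 * SL2 => x.1 * x.2)%g.
Proof.
apply: SL2_continuous => i j.
have cM k : continuous (fun t : SL2 * SL2 =>
    (t.1 : 'M[R]_2) i k * (t.2 : 'M[R]_2) k j).
  move=> t; apply: cvgM.
  - apply: (@continuous_comp _ _ _ fst (fun A : SL2 => (A : 'M[R]_2) i k)).
      exact: cvg_fst.
    exact: SL2_coord_continuous.
  - apply: (@continuous_comp _ _ _ snd (fun A : SL2 => (A : 'M[R]_2) k j)).
      exact: cvg_snd.
    exact: SL2_coord_continuous.
rewrite (_ : (fun _ => _) = fun t : SL2 * SL2 =>
    (t.1 : 'M[R]_2) i ord0 * (t.2 : 'M[R]_2) ord0 j +
    (t.1 : 'M[R]_2) i (lift ord0 ord0) * (t.2 : 'M[R]_2) (lift ord0 ord0) j).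
  by move=> t; apply: cvgD; exact: cM.
by apply/funext => t; rewrite mxE !big_ord_recl big_ord0 addr0.
Qed.

Lemma SL2_invE A i j : SL2_mx A^-1%g i j =
  (-1) ^+ (j + i) * (A : 'M[R]_2) (lift j ord0) (lift i ord0).
Proof.
rewrite [LHS](_ : _ = (invmx A) i j)// /invmx SL2_unit SL2_det invr1 scale1r.
by rewrite mxE /cofactor det_mx11 !mxE.
Qed.

Lemma SL2_inv_continuous : continuous (fun A : SL2 => A^-1)%g.
Proof.
apply: SL2_continuous => i j.
rewrite (_ : (fun _ => _) = fun A : SL2 =>
    (-1) ^+ (j + i) * (A : 'M[R]_2) (lift j ord0) (lift i ord0)).
  move=> A; apply: (@continuousM _ _ (cst ((-1) ^+ (j + i)))
    (fun A : SL2 => (A : 'M[R]_2) (lift j ord0) (lift i ord0))).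
    exact: cst_continuous.
  exact: SL2_coord_continuous.
by apply/funext => A; exact: SL2_invE.
Qed.

HB.instance Definition _ := isTopologicalGroup.Build SL2
  SL2_mul_continuous SL2_inv_continuous.

Definition SL2_pm A B : bool :=
  (SL2_mx A == SL2_mx B) || (SL2_mx A == - SL2_mx B).

Lemma SL2_pmP A B :
  reflect (SL2_mx A = SL2_mx B \/ SL2_mx A = - SL2_mx B) (SL2_pm A B).
Proof. by apply: (iffP orP) => -[/eqP|/eqP]; by [left|right]. Qed.

Lemma SL2_pm_refl : reflexive SL2_pm.
Proof. by move=> A; rewrite /SL2_pm eqxx. Qed.
Lemma SL2_pm_sym : symmetric SL2_pm.
Proof. by move=> A B; apply/SL2_pmP/SL2_pmP => -[->|->]; rewrite ?opprK; [left|right|left|right]. Qed.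
Lemma SL2_pm_trans : transitive SL2_pm.
Proof.
move=> B A C /SL2_pmP AB /SL2_pmP BC; apply/SL2_pmP.
by move: AB BC => [->|->] [->|->]; rewrite ?opprK; by [left|right].
Qed.

Definition SL2_pm_equiv : equiv_rel SL2 :=
  EquivRel SL2_pm SL2_pm_refl SL2_pm_sym SL2_pm_trans.

Lemma SL2_pm_mul A A' B B' : SL2_pm_equiv A A' -> SL2_pm_equiv B B' ->
  SL2_pm_equiv (A * B)%g (A' * B')%g.
Proof.
move=> /SL2_pmP AA' /SL2_pmP BB'; apply/SL2_pmP.
rewrite -[SL2_mx (A * B)%g]/(SL2_mx A *m SL2_mx B).
rewrite -[SL2_mx (A' * B')%g]/(SL2_mx A' *m SL2_mx B').
by move: AA' BB' => [->|->] [->|->];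
  rewrite ?(mulNmx, mulmxN) ?opprK; by [left|right].
Qed.

Definition SL2_pm_congruence : congruence SL2 := Congruence SL2_pm_mul.

Definition PSL2 := quotient_topology (quot_group SL2_pm_congruence).

HB.instance Definition _ := Topological.on PSL2.
HB.instance Definition _ := Group.copy PSL2 (quot_group SL2_pm_congruence).

Definition PSL2_pi (A : SL2) : PSL2 := \pi_PSL2 A.

Lemma PSL2_piM : {morph PSL2_pi : A B / (A * B)%g}.
Proof. exact: pi_mul. Qed.

Lemma PSL2_piV : {morph PSL2_pi : A / (A^-1)%g}.
Proof. exact: pi_inv. Qed.

HB.instance Definition _ := isMultiplicative.Build SL2 PSL2 PSL2_pi PSL2_piM.

Lemma PSL2_pi_surj x : PSL2_pi (repr x) = x.
Proof. exact: reprK. Qed.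

Lemma PSL2_pi_eqP A B :
  PSL2_pi A = PSL2_pi B <-> SL2_mx A = SL2_mx B \/ SL2_mx A = - SL2_mx B.
Proof.
split=> [/(quot_eqP SL2_pm_congruence)/SL2_pmP//|AB].
by apply/(quot_eqP SL2_pm_congruence)/SL2_pmP.
Qed.

Lemma PSL2_pi_continuous : continuous PSL2_pi.
Proof. exact: pi_continuous. Qed.

Lemma SL2_opp_subproof A : \det (- SL2_mx A) == 1.
Proof. by rewrite -scaleN1r detZ SL2_det mulr1 sqrrN expr1n. Qed.

Definition SL2_opp A : SL2 := exist _ (- SL2_mx A) (SL2_opp_subproof A).

Lemma SL2_opp_continuous : continuous SL2_opp.
Proof.
apply: SL2_continuous => i j.
rewrite (_ : (fun _ => _) = fun A : SL2 => - (A : 'M[R]_2) i j).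
  move=> A; apply: (@continuous_comp _ _ _ (fun A : SL2 => (A : 'M[R]_2) i j)
    (fun x : R => - x)).
    exact: SL2_coord_continuous.
  exact: opp_continuous.
by apply/funext => A; rewrite mxE.
Qed.

Lemma PSL2_pi_open A (U : set SL2) :
  nbhs A U -> nbhs (PSL2_pi A) (PSL2_pi @` U).
Proof.
rewrite nbhsE => -[V [oV VA] VU]; rewrite nbhsE.
exists (PSL2_pi @` V); last by move=> _ [B VB <-]; exists B => //; exact: VU.
split; last by exists A.
rewrite /open/= /quotient_open.
rewrite (_ : _ @^-1` _ = V `|` SL2_opp @^-1` V).
  by apply: openU => //; move/continuousP: SL2_opp_continuous; apply.
apply/seteqP; split=> [B [C VC /PSL2_pi_eqP CB]|B [VB|VB]].
- case: CB => CB; [left|right].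
    by rewrite (_ : B = C)//; apply: val_inj.
  by rewrite /preimage/= (_ : SL2_opp B = C)//; apply: val_inj.
- by exists B.
- by exists (SL2_opp B) => //; apply/PSL2_pi_eqP; right.
Qed.

Lemma PSL2_mul_continuous : continuous (fun x : PSL2 * PSL2 => x.1 * x.2)%g.
Proof.
move=> [x y] W; rewrite /= -[x]PSL2_pi_surj -[y]PSL2_pi_surj.
move: (repr x) (repr y) => A B; rewrite -PSL2_piM => nW.
have /= := @continuous_comp _ _ _ (fun z : SL2 * SL2 => z.1 * z.2)%g PSL2_pi
  (A, B) (@SL2_mul_continuous _) (@PSL2_pi_continuous _) _ nW.
case=> -[P Q]/= [nP nQ] PQ.
exists (PSL2_pi @` P, PSL2_pi @` Q); first by split; exact: PSL2_pi_open.
move=> [_ _] /= [[C PC <-] [D QD <-]].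
by rewrite -PSL2_piM; exact: (PQ (C, D)).
Qed.

Lemma PSL2_inv_continuous : continuous (fun x : PSL2 => x^-1)%g.
Proof.
move=> x W; rewrite -[x]PSL2_pi_surj; move: (repr x) => A.
rewrite -PSL2_piV => nW.
have /= nA := @continuous_comp _ _ _ (fun z : SL2 => z^-1)%g PSL2_pi
  A (@SL2_inv_continuous _) (@PSL2_pi_continuous _) _ nW.
apply: filterS (PSL2_pi_open nA) => _ [B WB <-].
by rewrite /= -PSL2_piV.
Qed.

HB.instance Definition _ := isTopologicalGroup.Build PSL2
  PSL2_mul_continuous PSL2_inv_continuous.

Definition trsq (x : PSL2) : R := (\tr (SL2_mx (repr x))) ^+ 2.

Lemma trsq_pi A : trsq (PSL2_pi A) = (\tr (SL2_mx A)) ^+ 2.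
Proof.
rewrite /trsq; have /PSL2_pi_eqP [->//|->] := PSL2_pi_surj (PSL2_pi A).
by rewrite raddfN sqrrN.
Qed.

(* The identity satisfies this too; [parabolic_free] below excludes it. *)
Definition parabolic (x : PSL2) : Prop := trsq x = 4.

End SL2.

Section Representations.
Variables (R : realType) (L : groupType).
Local Notation PSL := (PSL2 R).
Implicit Types rho lambda : {multiplicative L -> PSL}.

Definition faithful rho : Prop := injective rho.

Definition parabolic_free rho : Prop :=
  forall x, range rho x -> parabolic x -> x = 1%g.

Definition discrete_set (T : topologicalType) (A : set T) : Prop :=
  A `<=` isolated A.

Definition indiscrete rho : Prop := ~ discrete_set (range rho).

Definition liftable rho : Prop :=
  exists sigma : {multiplicative L -> universal_cover R PSL},
    forall g, rho g = covering_map (sigma g).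

Definition tracially_disjoint (Lambda : set {multiplicative L -> PSL}) : Prop :=
  forall rho lambda, Lambda rho -> Lambda lambda -> rho <> lambda ->
    [set trsq (rho g) | g in ~` torsion L] `&`
    [set trsq (lambda g) | g in ~` torsion L] = set0.

Definition liftable_flexible : Prop :=
  finitely_generated L /\
  exists Lambda : set {multiplicative L -> PSL},
    [/\ ~ countable Lambda, tracially_disjoint Lambda &
        forall rho, Lambda rho ->
          [/\ indiscrete rho, faithful rho, parabolic_free rho & liftable rho]].

End Representations.

(* Main.v *)
Require Import Defs.
From HB Require Import structures.
From mathcomp Require Import all_boot all_order all_algebra.
From mathcomp Require Import polyrcf.
From mathcomp Require Import all_classical all_reals.
From mathcomp Require Import topology normedtype sequences realfun exp trigo.
From mathcomp Require Import ring lra zify.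

(** A nontrivial limit group [L] has many homomorphisms to free groups, and free
    groups have many representations; the problem is to deform these to faithful
    representations of [L] itself. A single representation with good properties
    for finitely many elements of [L] is easy: compose a homomorphism to a free
    group with a Schottky representation. Since a cyclically reduced word of
    length [m] has as its trace a Laurent polynomial of degree [m] in the
    multiplier of the generators ([free_trace_poly]), the squared traces of the
    given elements can be made to avoid finitely many values.

    To treat all elements at once, index such representations by the finite
    lists of conditions that they satisfy, and take an ultrafilter on the lists.
    The entries of the generators become elements of an ultrapower of [R], a
    generic point of an irreducible subvariety of the representation variety
    on which no squared trace of a nontrivial element is constant. Adding the
    coordinates one at a time, each is either transcendental over the previous
    ones, hence free in an interval, or a simple root of its minimal
    polynomial, hence locally a continuous function of them
    ([generic_poly]). So near one of the given representations there is a
    path connected set of representations of [L] that contains, for every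
    countable set of values, a representation whose squared traces at nontrivial
    elements avoid it ([deformation]).

    Avoiding 4 makes the representation faithful and free of parabolics.
    Liftability is automatic: every representation in sight is joined to the
    trivial one by a path of representations, that is, by a homomorphism to the
    group of based paths, and the class of the path is the lift
    ([path_rep_liftable]). For indiscreteness, a nonabelian [L] is represented
    with two noncommuting elements so close to 1 that their iterated commutators
    converge to 1 ([noncommuting_indiscrete]); an abelian [L] is represented by
    rotations ([rotation_indiscrete]). Finally, a maximal tracially disjoint
    family of such representations is uncountable, since otherwise the countable
    set of its squared traces could be avoided by one more representation. *)

Set Implicit Arguments.
Unset Strict Implicit.
Unset Printing Implicit Defensive.

Import Order.TTheory GRing.Theory Num.Theory.
Import numFieldNormedType.Exports.

Local Open Scope classical_set_scope.
Local Open Scope ring_scope.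

(** * Polynomials vanishing along an ultrafilter *)

Section Vanishing.
Variables (R : realType) (I : Type) (U : set_system I).
Hypothesis UU : UltraFilter U.

(** For an ultrafilter [U] the vanishing elements form a prime ideal, the kernel
    of the map from [A] to the ultrapower of [R]. All the algebra below takes
    place in the quotient, but elements of [A] are kept as representatives
    because they can be evaluated at other points. *)
Definition vanishes (A : nzRingType) (e : I -> {rmorphism A -> R}) (p : A) :=
  U [set i | e i p = 0].

(** A specialization, that is, a point of the zero set of the ideal of vanishing
    elements. *)
Definition kills (A : nzRingType) (e : I -> {rmorphism A -> R})
    (f : {rmorphism A -> R}) :=
  forall p, vanishes e p -> f p = 0.

Definition eval_at (A : nzRingType) (f : {rmorphism A -> R}) (y : R) :
    {rmorphism {poly A} -> R} := horner_eval y \o map_poly f.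

Lemma eval_atE (A : nzRingType) (f : {rmorphism A -> R}) y p :
  eval_at f y p = (map_poly f p).[y].
Proof. by []. Qed.

Lemma eval_atC (A : nzRingType) (f : {rmorphism A -> R}) y c :
  eval_at f y c%:P = f c.
Proof. by rewrite eval_atE map_polyC hornerC. Qed.

Lemma eval_atZ (A : nzRingType) (f : {rmorphism A -> R}) y c p :
  eval_at f y (c *: p) = f c * eval_at f y p.
Proof. by rewrite -mul_polyC rmorphM eval_atC. Qed.

Section Ring.
Variables (A : nzRingType) (e : I -> {rmorphism A -> R}).
Local Notation van := (vanishes e).

Lemma vanishesPn p : ~ van p -> U [set i | e i p != 0].
Proof.
move=> np; have [//|] := in_ultra_setVsetC [set i | e i p = 0] UU.
by apply: filterS => i /= /eqP.
Qed.

Lemma nvanishes p : U [set i | e i p != 0] -> ~ van p.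
Proof.
by move=> h h'; have [i [/= /eqP]] := filter_ex (filterI h h').
Qed.

Lemma vanishes0 : van 0.
Proof. by apply: filterE => i /=; rewrite rmorph0. Qed.

Lemma vanishesD p q : van p -> van q -> van (p + q).
Proof. by apply: filterS2 => i /= hp hq; rewrite rmorphD /= hp hq addr0. Qed.

Lemma vanishesN p : van p -> van (- p).
Proof. by apply: filterS => i /= hp; rewrite rmorphN /= hp oppr0. Qed.

Lemma vanishesMl p q : van q -> van (p * q).
Proof. by apply: filterS => i /= hp; rewrite rmorphM /= hp mulr0. Qed.

Lemma vanishesMr p q : van p -> van (p * q).
Proof. by apply: filterS => i /= hp; rewrite rmorphM /= hp mul0r. Qed.

Lemma nvanishesM p q : ~ van p -> ~ van q -> ~ van (p * q).
Proof.
move=> /vanishesPn hp /vanishesPn hq; apply: nvanishes.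
by apply: filterS2 hp hq => i /= hp hq; rewrite rmorphM mulf_neq0.
Qed.

Lemma nvanishesX p n : ~ van p -> ~ van (p ^+ n).
Proof.
move=> hp; elim: n => [|n IH]; last by rewrite exprS; exact: nvanishesM.
by apply: nvanishes; apply: filterE => i /=; rewrite rmorph1 oner_neq0.
Qed.

End Ring.

Section Poly.
Variables (A : idomainType) (e : I -> {rmorphism A -> R}) (y : I -> R).
Local Notation van := (vanishes e).
Local Notation vanp := (vanishes (fun i => eval_at (e i) (y i))).
Implicit Types p q r F : {poly A}.

Definition null_poly p := forall j, van p`_j.

(** Deleting the vanishing coefficients is what makes the leading coefficient
    of a polynomial meaningful at the generic point. *)
Definition reduce p :=
  \poly_(j < size p) (if `[< van p`_j >] then 0 else p`_j).

Lemma reduce_lead p : reduce p = 0 \/ ~ van (lead_coef (reduce p)).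
Proof.
have [->|] := eqVneq (reduce p) 0; [by left|rewrite -lead_coef_eq0 => h; right].
move: h; rewrite lead_coefE coef_poly; case: ltnP => [_|_]; last by rewrite eqxx.
by case: asboolP => //; rewrite eqxx.
Qed.

Lemma reduce_null p : null_poly (p - reduce p).
Proof.
move=> j; rewrite coefB coef_poly; case: ltnP => [_|hj].
  by case: asboolP => [h|_]; rewrite ?subr0 ?subrr //; exact: vanishes0.
by rewrite nth_default // subrr; exact: vanishes0.
Qed.

Lemma reduce_size p : (size (reduce p) <= size p)%N.
Proof. exact: size_poly. Qed.

Lemma null_kills f p z : kills e f -> null_poly p -> eval_at f z p = 0.
Proof.
move=> kf np; rewrite eval_atE (_ : map_poly f p = 0) ?horner0 //.
by apply/polyP => j; rewrite coef_map coef0 /= kf.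
Qed.

Lemma null_vanishes p : null_poly p -> vanp p.
Proof.
move=> np.
have : U [set i | forall j : 'I_(size p), e i p`_j = 0].
  by apply: filter_forall => j; exact: np.
apply: filterS => i /= h; rewrite (_ : map_poly (e i) p = 0) ?rmorph0 //.
apply/polyP => j; rewrite coef_map coef0 /=.
have [hj|hj] := ltnP j (size p); first exact: (h (Ordinal hj)).
by rewrite nth_default // rmorph0.
Qed.

Lemma reduce_vanishes p : vanp p -> vanp (reduce p).
Proof.
move=> h; rewrite (_ : reduce p = p - (p - reduce p)); last by rewrite opprB addrC subrK.
apply: vanishesD => //; apply: vanishesN; exact/null_vanishes/reduce_null.
Qed.


Lemma kills_reduce f p z : kills e f ->
  eval_at f z p = eval_at f z (reduce p).
Proof.
move=> kf; apply/eqP; rewrite -subr_eq0 -rmorphB; apply/eqP.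
exact: null_kills kf (@reduce_null _).
Qed.

Lemma nvanishes_coef p : ~ vanp p -> exists j, ~ van p`_j.
Proof.
by move=> np; apply: contra_notP np => /forallNP h; apply: null_vanishes => j; apply: contrapT.
Qed.

Lemma vanishesC c : vanp c%:P -> van c.
Proof. by apply: filterS => i /=; rewrite map_polyC /horner_eval hornerC. Qed.

(** The coordinate [y] is transcendental over [A] when no polynomial with
    nonvanishing leading coefficient vanishes at [y]. *)
Lemma transcendental_null p :
  (forall q, ~ van (lead_coef q) -> ~ vanp q) -> vanp p -> null_poly p.
Proof.
move=> tr vp; have [r0|nl] := reduce_lead p; last by case: (tr _ nl (reduce_vanishes vp)).
by have := @reduce_null p; rewrite r0 subr0.
Qed.

Section Algebraic.
Variable p : {poly A}.
Hypotheses (np : ~ van (lead_coef p)) (vp : vanp p).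
Hypothesis minp :
  forall q, ~ van (lead_coef q) -> vanp q -> (size p <= size q)%N.

(** By minimality of [p] the only relations of smaller degree are trivial. *)
Lemma min_null r : vanp r -> (size r < size p)%N -> null_poly r.
Proof.
move=> vr lt; have [r0|nl] := reduce_lead r.
  by have := @reduce_null r; rewrite r0 subr0.
have := minp nl (reduce_vanishes vr).
by rewrite leqNgt (leq_ltn_trans (reduce_size _) lt).
Qed.

Lemma nlead_neq0 q : ~ van (lead_coef q) -> q != 0.
Proof.
by move=> h; apply/eqP => q0; apply: h; rewrite q0 lead_coef0; exact: vanishes0.
Qed.

(** Up to a power of the leading coefficient of [p] and up to vanishing
    coefficients, [F] is a multiple of the minimal polynomial [p]. *)
Lemma algebraic_null F f z : vanp F -> kills e f ->
  f (lead_coef p) != 0 -> eval_at f z p = 0 -> eval_at f z F = 0.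
Proof.
move=> vF kf l0 pz; have E := Pdiv.Idomain.divp_eq F p.
have : vanp (F %% p).
  rewrite -[F %% p](addKr (F %/ p * p)) -E.
  apply: vanishesD; first by apply: vanishesN; exact: vanishesMl.
  by rewrite -mul_polyC; exact: vanishesMl.
move=> /min_null; rewrite ltn_modp (nlead_neq0 np) => /(_ isT) nr.
have := congr1 (eval_at f z) E.
rewrite eval_atZ rmorphD rmorphM pz mulr0 add0r (null_kills z kf nr) => /eqP.
by rewrite rmorphXn mulf_eq0 expf_eq0 (negPf l0) andbF => /eqP.
Qed.

(** Euclid's algorithm between [F] and the minimal polynomial [p] ends at a
    nonvanishing constant [c] of the ideal they generate. *)
Lemma algebraic_generic F : ~ vanp F -> exists c, ~ van c /\
  forall f z, kills e f -> eval_at f z p = 0 -> f c != 0 -> eval_at f z F != 0.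
Proof.
(* Each division decreases the size of [F] or replaces it by a remainder of [p];
   a vanishing remainder is excluded because it would factor [p]. *)
have [n] := ubnP (size F); elim: n F => // n IH F; rewrite ltnS => sF nF.
suff [c [nc hc]] : exists c, ~ van c /\ forall f z, kills e f ->
    eval_at f z p = 0 -> f c != 0 -> eval_at f z (reduce F) != 0.
  by exists c; split=> // f z kf pz c0; rewrite kills_reduce //; exact: hc.
have nF1 : ~ vanp (reduce F).
  apply: contra_not nF => h; rewrite -(subrK (reduce F) F).
  by apply: vanishesD => //; apply: null_vanishes; exact: reduce_null.
have [F10|nl] := reduce_lead F.
  by case: nF1; rewrite F10; exact: vanishes0.
have sF1 : (size (reduce F) <= n)%N by rewrite (leq_trans (reduce_size _)).
move: (reduce F) nF1 nl sF1 => {F nF sF} F nF nl sF.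
have F0 := nlead_neq0 nl; have p0 := nlead_neq0 np.
have [s1|s1] := leqP (size F) 1.
  exists (lead_coef F); split=> // f z _ _; rewrite (size1_polyC s1) eval_atC.
  by rewrite lead_coefC.
have [le|lt] := leqP (size p) (size F).
  have E := Pdiv.Idomain.divp_eq F p.
  have nr : ~ vanp (F %% p).
    move=> vr.
    have vlF : vanp ((lead_coef p ^+ scalp F p) *: F).
      by rewrite E; apply: vanishesD => //; exact: vanishesMl.
    move: vlF; rewrite -mul_polyC; apply: nvanishesM => //.
    by move=> /vanishesC; exact: nvanishesX.
  have [|c [nc hc]] := IH (F %% p) _ nr.
    by rewrite (leq_trans _ sF) // (leq_trans _ le) // ltn_modp.
  exists c; split=> // f z kf pz c0; apply: contra_neq (hc f z kf pz c0) => Fz.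
  have := congr1 (eval_at f z) E.
  by rewrite eval_atZ rmorphD rmorphM pz Fz !mulr0 add0r => <-.
have E := Pdiv.Idomain.divp_eq p F.
have [vr|nr] := pselect (vanp (p %% F)); last first.
  have [|c [nc hc]] := IH (p %% F) _ nr.
    by rewrite (leq_trans _ sF) // ltn_modp.
  exists c; split=> // f z kf pz c0; apply: contra_neq (hc f z kf pz c0) => Fz.
  have := congr1 (eval_at f z) E.
  by rewrite eval_atZ rmorphD rmorphM pz Fz !mulr0 add0r => <-.
exfalso.
have sr : (size (p %% F)%R < size p)%N.
  by rewrite (leq_trans _ (ltnW lt)) // ltn_modp.
have nr := min_null vr sr.
have l0 : lead_coef F ^+ scalp p F != 0 by rewrite expf_neq0 // lead_coef_eq0.
have qF : p %/ F * F = (lead_coef F ^+ scalp p F) *: p - p %% F.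
  by rewrite E addrK.
have sqF : size (p %/ F * F)%R = size p.
  by rewrite qF size_polyDl ?size_polyN size_scale.
have q0 : p %/ F != 0.
  apply: contraNneq p0 => q0; move: sqF; rewrite q0 mul0r size_poly0.
  by move/esym/eqP; rewrite size_poly_eq0.
have vq : vanp (p %/ F).
  apply: contrapT => nq; apply: (nvanishesM nq nF); rewrite qF.
  apply: vanishesD; last exact: vanishesN.
  by rewrite -mul_polyC; exact: vanishesMl.
have nq : null_poly (p %/ F).
  apply: min_null => //; rewrite -sqF size_mul // -subn1.
  by move: s1; case: (size F) => [|[|k]] // _; rewrite !addnS subn1 /= -addSn leq_addr.
have := nvanishesM (nvanishesX (n := scalp p F) nl) np; apply.
have -> : lead_coef F ^+ scalp p F * lead_coef p =
    ((lead_coef F ^+ scalp p F) *: p)`_(size p).-1 by rewrite coefZ -lead_coefE.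
rewrite E coefD; apply: vanishesD; last exact: nr.
rewrite coefM; elim/big_rec: _ => [|i x _ hx]; first exact: vanishes0.
by apply: vanishesD => //; apply: vanishesMr; exact: nq.
Qed.

(** The derivative has smaller degree than the minimal polynomial, and it is not
    zero in characteristic 0; hence the root is simple. *)
Lemma algebraic_separable : ~ vanp p^`().
Proof.
move=> vd.
have p0 := nlead_neq0 np.
have nd := min_null vd (lt_size_deriv p0).
have s1 : (1 < size p)%N.
  rewrite ltnNge; apply/negP => s1; apply: np; apply: vanishesC.
  by move: vp; rewrite (size1_polyC s1) lead_coefC.
have := nd (size p).-2; rewrite coef_deriv prednK -?subn1 ?subn_gt0 //.
rewrite subn1 -lead_coefE => h; apply: np; apply: filterS h => i /=.
rewrite rmorphMn /= => /eqP; rewrite mulrn_eq0 => /orP[|/eqP //].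
by case: (size p) s1 => [|[]].
Qed.

End Algebraic.
End Poly.
End Vanishing.

(** * Implicit functions *)

Section ImplicitRoot.
Variables (R : realType) (V : topologicalType).
Implicit Types (G : V -> R -> R) (D : V -> R -> R -> R).

(** On a small box [G] is increasing in the unknown and changes sign, so it has a
    unique zero there; the signs of [G] just above and just below this zero
    persist at nearby parameters, which makes the zero continuous. *)
Lemma implicit_root_pos G D (v0 : V) (y0 : R) (O : set (V * R)) :
  (forall y, continuous (fun v => G v y)) -> (forall v, continuous (G v)) ->
  (forall v y1 y2, G v y1 - G v y2 = (y1 - y2) * D v y1 y2) ->
  {for (v0, y0, y0), continuous (fun z : V * R * R => D z.1.1 z.1.2 z.2)} ->
  G v0 y0 = 0 -> 0 < D v0 y0 y0 -> nbhs (v0, y0) O ->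
  exists (W : set V) (alpha : V -> R),
    [/\ nbhs v0 W, alpha v0 = y0 &
        forall v, W v ->
          [/\ G v (alpha v) = 0, O (v, alpha v) & {for v, continuous alpha}]].
Proof.
move=> Gv Gy GD Dc G0 D0 nO.
have nD : \forall z \near (v0, y0, y0), 0 < D z.1.1 z.1.2 z.2.
  by apply: (Dc [set r | 0 < r]); apply: open_nbhs_nbhs; split => //; exact: open_gt.
have [[A B] /= [[[A1 A2] /= [nA1 nA2] A12] nB] AB] := nD.
have [[O1 O2] /= [nO1 nO2] O12] := nO.
have : nbhs y0 (A2 `&` B `&` O2) by apply: filterI => //; exact: filterI.
move=> /nbhs_ballP [d0 /= d00 hd0].
pose d := d0 / 2; have d_gt0 : 0 < d by rewrite divr_gt0.
have ind y : `|y - y0| <= d -> [/\ A2 y, B y & O2 y].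
  move=> hy; have [|[? ?] ?] := hd0 y; last by split.
  rewrite /ball /= distrC (le_lt_trans hy) // /d.
  by rewrite ltr_pdivrMr // ltr_pMr // ltr1n.
have Dpos v y1 y2 : A1 v -> `|y1 - y0| <= d -> `|y2 - y0| <= d -> 0 < D v y1 y2.
  move=> v1 /ind[a1 _ _] /ind[_ b2 _].
  by apply: (AB (v, y1, y2)); split => //=; exact: A12.
have dd s : `|y0 + s * d - y0| = `|s| * d.
  by rewrite [y0 + _]addrC addrK normrM (gtr0_norm d_gt0).
have hp : `|y0 + d - y0| <= d by have := dd 1; rewrite mul1r normr1 mul1r => ->.
have hm : `|y0 - d - y0| <= d.
  by have := dd (-1); rewrite mulN1r normrN1 mul1r => ->.
have h0 : `|y0 - y0| <= d by rewrite subrr normr0 ltW.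
have A1v0 : A1 v0 by exact: nbhs_singleton.
have Gp : 0 < G v0 (y0 + d).
  by have := GD v0 (y0 + d) y0; rewrite G0 subr0 [y0 + d - y0]addrAC subrr add0r => ->; rewrite mulr_gt0 ?Dpos.
have Gm : G v0 (y0 - d) < 0.
  have := GD v0 (y0 - d) y0; rewrite G0 subr0 [y0 - d - y0]addrAC subrr add0r => ->.
  by rewrite mulNr oppr_lt0 mulr_gt0 ?Dpos.
have nGp : nbhs v0 [set v | 0 < G v (y0 + d)].
  by apply: (Gv (y0 + d) v0 [set r | 0 < r]); apply: open_nbhs_nbhs; split => //; exact: open_gt.
have nGm : nbhs v0 [set v | G v (y0 - d) < 0].
  by apply: (Gv (y0 - d) v0 [set r | r < 0]); apply: open_nbhs_nbhs; split => //; exact: open_lt.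
pose W0 := A1 `&` O1 `&` [set v | 0 < G v (y0 + d)] `&` [set v | G v (y0 - d) < 0].
have nW0 : nbhs v0 W0 by do !apply: filterI => //.
have rootW v : exists y, W0 v -> [/\ y0 - d < y, y < y0 + d & G v y = 0].
  have [[[[Av Ov] Gpv] Gmv]|nW] := pselect (W0 v); last by exists y0 => /nW.
  have le : y0 - d <= y0 + d by rewrite lerD2l; lra.
  have [||c /[!in_itv] /= /andP[c1 c2] Gc] := @IVT R (G v) _ _ 0 le.
  - by apply: continuous_subspaceT => y; exact: Gy.
  - rewrite min_l ?max_r ?(ltW Gpv) ?(ltW Gmv) //;
      by rewrite (le_trans (ltW Gmv)) // ltW.
  exists c => _; split => //; rewrite lt_neqAle ?c1 ?c2 andbT.
    by apply: contraTneq Gmv => ->; rewrite Gc ltxx.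
  by apply: contraTneq Gpv => <-; rewrite Gc ltxx.
have [alpha halpha] := choice rootW.
have inI v : W0 v -> `|alpha v - y0| <= d.
  by move=> /halpha[h1 h2 _]; rewrite ler_norml; apply/andP; split; lra.
have uniq v y : W0 v -> `|y - y0| <= d -> G v y = 0 -> y = alpha v.
  move=> Wv hy Gyv; have [_ _ Ga] := halpha v Wv.
  have := GD v y (alpha v); rewrite Gyv Ga subrr => /esym/eqP.
  case: Wv (Wv) => [[[Av _] _] _] Wv.
  by rewrite mulf_eq0 (gt_eqF (Dpos _ _ _ Av hy (inI _ Wv))) orbF subr_eq0 => /eqP.
exists (interior W0), alpha; split.
- exact: nbhs_interior.
- by rewrite -(uniq v0 y0) //; exact: nbhs_singleton.
move=> v iWv; have Wv : W0 v := interior_subset iWv.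
have [a1 a2 Ga] := halpha v Wv; split => //.
  have [_ _ O2a] := ind _ (inI _ Wv).
  by apply: O12; split => //=; case: Wv => [[[]]].
apply/cvgrPdist_lt => eps eps0.
pose eta := Num.min (eps / 2) (Num.min (y0 + d - alpha v) (alpha v - (y0 - d))).
have eta0 : 0 < eta by rewrite !lt_min; apply/and3P; split; lra.
have eta1 : eta <= eps / 2 by rewrite ge_min lexx.
have eta2 : eta <= y0 + d - alpha v by rewrite /eta minCA ge_min lexx.
have eta3 : eta <= alpha v - (y0 - d) by rewrite /eta minA minC ge_min lexx.
have Av : A1 v by case: Wv => [[[]]].
have ip : `|alpha v + eta - y0| <= d by rewrite ler_norml; apply/andP; split; lra.
have im : `|alpha v - eta - y0| <= d by rewrite ler_norml; apply/andP; split; lra.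
have Gap : 0 < G v (alpha v + eta).
  have := GD v (alpha v + eta) (alpha v); rewrite Ga subr0 => ->.
  rewrite [alpha v + eta - _]addrAC subrr add0r.
  by rewrite mulr_gt0 // Dpos // inI.
have Gam : G v (alpha v - eta) < 0.
  have := GD v (alpha v - eta) (alpha v); rewrite Ga subr0 => ->.
  rewrite (_ : alpha v - eta - alpha v = - eta); last by lra.
  by rewrite mulNr oppr_lt0 mulr_gt0 // Dpos // inI.
have nap : nbhs v [set w | 0 < G w (alpha v + eta)].
  by apply: (Gv _ v [set r | 0 < r]); apply: open_nbhs_nbhs; split => //; exact: open_gt.
have nam : nbhs v [set w | G w (alpha v - eta) < 0].
  by apply: (Gv _ v [set r | r < 0]); apply: open_nbhs_nbhs; split => //; exact: open_lt.
near=> w.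
have Ww : W0 w by near: w.
have wp : 0 < G w (alpha v + eta) by near: w.
have wm : G w (alpha v - eta) < 0 by near: w.
have Aw : A1 w by case: Ww => [[[]]].
have [_ _ Gaw] := halpha w Ww.
suff : `|alpha v - alpha w| <= eta by move=> h; rewrite (le_lt_trans h) //; lra.
rewrite ler_norml; apply/andP; split.
- rewrite leNgt; apply/negP => lt.
  have := GD w (alpha v + eta) (alpha w); rewrite Gaw subr0 => e.
  have D1 := Dpos w _ _ Aw ip (inI _ Ww).
  have : (alpha v + eta - alpha w) * D w (alpha v + eta) (alpha w) < 0.
    by rewrite pmulr_llt0 //; lra.
  by lra.
- rewrite leNgt; apply/negP => lt.
  have := GD w (alpha v - eta) (alpha w); rewrite Gaw subr0 => e.
  have D1 := Dpos w _ _ Aw im (inI _ Ww).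
  have : 0 < (alpha v - eta - alpha w) * D w (alpha v - eta) (alpha w).
    by rewrite mulr_gt0 //; lra.
  by lra.
Unshelve. all: by end_near.
Qed.

(** The implicit function theorem in one unknown, with the difference quotient [D]
    of [G] in place of its derivative. *)
Lemma implicit_root G D (v0 : V) (y0 : R) (O : set (V * R)) :
  (forall y, continuous (fun v => G v y)) -> (forall v, continuous (G v)) ->
  (forall v y1 y2, G v y1 - G v y2 = (y1 - y2) * D v y1 y2) ->
  {for (v0, y0, y0), continuous (fun z : V * R * R => D z.1.1 z.1.2 z.2)} ->
  G v0 y0 = 0 -> D v0 y0 y0 != 0 -> nbhs (v0, y0) O ->
  exists (W : set V) (alpha : V -> R),
    [/\ nbhs v0 W, alpha v0 = y0 &
        forall v, W v ->
          [/\ G v (alpha v) = 0, O (v, alpha v) & {for v, continuous alpha}]].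
Proof.
move=> Gv Gy GD Dc G0; rewrite neq_lt => /orP[D0 nO|D0 nO]; last first.
  exact: (implicit_root_pos Gv Gy GD Dc G0 D0 nO).
have [| | | | | |W [alpha [nW a0 h]]] := @implicit_root_pos
    (fun v y => - G v y) (fun v y1 y2 => - D v y1 y2) v0 y0 O _ _ _ _ _ _ nO.
- by move=> y v; apply: cvgN; exact: Gv.
- by move=> v y; apply: cvgN; exact: Gy.
- by move=> v y1 y2; rewrite mulrN -GD opprB opprK addrC.
- by apply: cvgN; exact: Dc.
- by rewrite G0 oppr0.
- by rewrite oppr_gt0.
exists W, alpha; split => // v /h[Ga ? ?]; split => //.
by apply/eqP; rewrite -oppr_eq0 Ga.
Qed.

End ImplicitRoot.

(** * Countable exceptional sets of reals *)

Section Reals.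
Variable R : realType.

(** The retraction of the line onto the unit interval; it turns paths on the unit
    interval into maps that are continuous on the whole line. *)
Definition clamp (t : R) : R := Num.max 0 (Num.min t 1).

Lemma clamp_in t : 0 <= clamp t <= 1.
Proof. by rewrite /clamp le_max lexx /= ge_max ler01 ge_min lexx orbT. Qed.

Lemma clamp_id t : 0 <= t <= 1 -> clamp t = t.
Proof. by move=> /andP[t0 t1]; rewrite /clamp min_l // max_r. Qed.

Lemma clamp_le0 t : t <= 0 -> clamp t = 0.
Proof. by move=> t0; rewrite /clamp max_l // ge_min t0. Qed.

Lemma clamp_ge1 t : 1 <= t -> clamp t = 1.
Proof. by move=> t1; rewrite /clamp min_r // max_r. Qed.

Lemma clamp_continuous : continuous clamp.
Proof.
move=> t; apply: (@continuous_max R R (fun=> 0) (fun t => Num.min t 1)).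
  exact: cst_continuous.
by apply: (@continuous_min R R id (fun=> 1)) => //; exact: cst_continuous.
Qed.

Lemma interval_avoid (a b : R) (C : set R) : a < b -> countable C ->
  exists y, [/\ a < y, y < b & ~ C y].
Proof.
move=> ab /pfcard_geP[C0|[f]].
  by exists ((a + b) / 2); rewrite C0; split => //; lra.
(* Baire: the complements of the points of [C] are open and dense. *)
have dB : dense (\bigcap_n ~` [set f n]).
  apply: (@Baire R R) => n; split.
    by apply: closed_openC; exact: closed_eq.
  move=> O [x Ox] oO.
  have /nbhs_ballP[e /= e0 he] : nbhs x O by exact: open_nbhs_nbhs.
  have [xf|/eqP xf] := eqVneq x (f n); last by exists x.
  exists (x + e / 2); split; last by move=> /= h; lra.
  by apply: he; rewrite /ball /= opprD addNKr normrN gtr0_norm; lra.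
have [||y [[/= ay yb] hy]] := dB ([set y | a < y] `&` [set y | y < b]).
- by exists ((a + b) / 2); split => /=; lra.
- by apply: openI; [exact: open_gt|exact: open_lt].
exists y; split => // /(@surj _ _ _ _ f)[n _ fn].
by apply: (hy n I); rewrite /= fn.
Qed.

Lemma countable_roots (p : {poly R}) : p != 0 -> countable [set x | root p x].
Proof.
move=> p0; apply: (@sub_countable _ _ _ [set` rootsR p]).
  apply: subset_card_le => x /= px.
  by rewrite -(roots_on_rootsR p0) px in_itv.
exact/finite_set_countable/finite_seq.
Qed.

Lemma continuous_sum_fun (T : topologicalType) (J : Type) (s : seq J)
    (P : pred J) (f : J -> T -> R) (t : T) :
  (forall j, f j x @[x --> t] --> f j t) ->
  \sum_(j <- s | P j) f j x @[x --> t] --> \sum_(j <- s | P j) f j t.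
Proof.
move=> cf; elim: s => [|j s IH].
  rewrite big_nil; under eq_fun do rewrite big_nil; exact: cvg_cst.
rewrite big_cons; under eq_fun do rewrite big_cons.
by case: (P j) => //; apply: cvgD => //; exact: cf.
Qed.

Lemma continuous_exp_fun (T : topologicalType) (f : T -> R) n (t : T) :
  f x @[x --> t] --> f t -> f x ^+ n @[x --> t] --> f t ^+ n.
Proof. by move=> cf; apply: (@continuous_comp _ _ _ f (fun x => x ^+ n)) => //; exact: exprn_continuous. Qed.

End Reals.

(** * Generic families of points *)

Section GenericFamily.
Variables (R : realType) (I : Type) (U : set_system I).
Hypothesis UU : UltraFilter U.

(** The paths run inside [S] for all times, so that a function that is
    constant on [S] is constant along them. *)
Definition starlike (V : topologicalType) (S : set V) (a : V) :=
  forall s, S s -> exists g : R -> V,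
    [/\ continuous g, g 0 = a, g 1 = s & forall t, S (g t)].

Definition eval_continuous (A : nzRingType) (V : topologicalType)
    (e : V -> {rmorphism A -> R}) :=
  forall p, continuous (fun v => e v p).

(** For most [i], arbitrarily close to [a i] there is a path connected set of
    points that satisfy all algebraic relations holding along the ultrafilter,
    and that is large enough to contain, for any countable list of relations
    that fail along the ultrafilter, a point where all of them fail. It replaces
    a neighbourhood of a smooth real point of the variety defined by the
    vanishing elements. *)
Definition generic (A : nzRingType) (V : topologicalType)
    (e : V -> {rmorphism A -> R}) (a : I -> V) :=
  let ea i := e (a i) in
  U [set i | forall O, nbhs (a i) O -> exists S : set V,
    [/\ S `<=` O, S (a i), starlike S (a i),
        forall s, S s -> kills U ea (e s) &
        forall f : nat -> A, (forall j, ~ vanishes U ea (f j)) ->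
          exists s, S s /\ forall j, e s (f j) != 0]].

Definition eval_poly (A : nzRingType) (V : Type)
    (e : V -> {rmorphism A -> R}) (v : V * R) : {rmorphism {poly A} -> R} :=
  eval_at (e v.1) v.2.

Lemma eval_polyE (A : nzRingType) (V : Type) (e : V -> {rmorphism A -> R})
    (v : V * R) p :
  eval_poly e v p = \sum_(j < size p) e v.1 p`_j * v.2 ^+ j.
Proof.
rewrite /eval_poly eval_atE (@horner_coef_wide _ (size p)) ?size_poly //.
by apply: eq_bigr => j _; rewrite coef_map.
Qed.

Section Step.
Variables (A : idomainType) (V : topologicalType).
Variables (e : V -> {rmorphism A -> R}) (a : I -> V) (y : I -> R).
Hypothesis ce : eval_continuous e.
Let ay i := (a i, y i).
Let ea i := e (a i).
Local Notation van := (vanishes U ea).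
Local Notation vanp := (vanishes U (fun i => eval_at (ea i) (y i))).

Lemma eval_poly_continuous : eval_continuous (eval_poly e).
Proof.
move=> p; rewrite (funext (fun v => eval_polyE e v p)) => z.
apply: continuous_sum_fun => j; apply: cvgM.
  apply: (@continuous_comp _ _ _ fst (fun v => e v p`_j)); first exact: cvg_fst.
  exact: ce.
by apply: continuous_exp_fun; exact: cvg_snd.
Qed.

Definition diff_quot (p : {poly A}) (v : V) (y1 y2 : R) : R :=
  \sum_(j < size p) e v p`_j * \sum_(k < j) y1 ^+ (j.-1 - k) * y2 ^+ k.

Lemma diff_quotE p v y1 y2 :
  eval_at (e v) y1 p - eval_at (e v) y2 p = (y1 - y2) * diff_quot p v y1 y2.
Proof.
rewrite -[eval_at _ y1 p]/(eval_poly e (v, y1) p).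
rewrite -[eval_at _ y2 p]/(eval_poly e (v, y2) p) !eval_polyE /=.
rewrite -sumrB mulr_sumr; apply: eq_bigr => j _.
by rewrite -mulrBr subrXX mulrCA.
Qed.

Lemma diff_quot_continuous p :
  continuous (fun z : V * R * R => diff_quot p z.1.1 z.1.2 z.2).
Proof.
have c1 : continuous (fun z : V * R * R => z.1.1).
  move=> z; apply: (@continuous_comp _ _ _ fst fst); exact: cvg_fst.
have c2 : continuous (fun z : V * R * R => z.1.2).
  move=> z; apply: (@continuous_comp _ _ _ fst snd); [exact: cvg_fst|exact: cvg_snd].
move=> z; apply: continuous_sum_fun => j; apply: cvgM.
  apply: (@continuous_comp _ _ _ (fun z : V * R * R => z.1.1)
    (fun v => e v p`_j)); [exact: c1|exact: ce].
apply: continuous_sum_fun => k; apply: cvgM; apply: continuous_exp_fun.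
  exact: c2.
exact: cvg_snd.
Qed.

(** All relations come from the previous coordinates, so the new coordinate can
    vary freely in an interval; there it only has to avoid the roots of
    countably many polynomials. *)
Lemma generic_transcendental :
  (forall q, ~ van (lead_coef q) -> ~ vanp q) ->
  generic e a -> generic (eval_poly e) ay.
Proof.
move=> tr; apply: filterS => i hi O [[O1 O2] /= [nO1 nO2] O12].
have [r /= r0 hr] := (nbhs_ballP _ _).1 nO2.
have [S [SO Sa starS killS genS]] := hi O1 nO1.
pose S' := [set z : V * R | S z.1 /\ `|z.2 - y i| < r].
have knull s z p : S s -> vanp p -> eval_at (e s) z p = 0.
  by move=> Ss /(transcendental_null UU tr); apply: null_kills; exact: killS.
exists S'; split.
- move=> [v z] [/= /SO Ov hz]; apply: O12; split => //=.
  by apply: hr; rewrite /ball /= distrC.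
- by split => //=; rewrite subrr normr0.
- move=> [v z] [/= Sv hz]; have [g [cg g0 g1 Sg]] := starS v Sv.
  exists (fun t => (g t, y i + clamp t * (z - y i))); split.
  + have cy : continuous (fun t => y i + clamp t * (z - y i)).
      move=> t; apply: cvgD; first exact: cvg_cst.
      by apply: cvgM; [exact: clamp_continuous|exact: cvg_cst].
    by move=> t; exact: (cvg_pair (cg t) (cy t)).
  + by rewrite g0 clamp_le0 // mul0r addr0.
  + by rewrite g1 clamp_ge1 // mul1r addrC subrK.
  + move=> t; split => //=; rewrite [_ + clamp t * _]addrC addrK normrM.
    have /andP[c0 c1] := clamp_in t; rewrite ger0_norm //.
    by rewrite (le_lt_trans _ hz) // ler_piMl.
- by move=> [v z] [/= Sv _] p; exact: knull.
- move=> f nf; have [c hc] := choice (fun j => nvanishes_coef UU (nf j)).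
  have [s [Ss hs]] := genS (fun j => (f j)`_(c j)) hc.
  have fs0 j : map_poly (e s) (f j) != 0.
    by apply: contraNneq (hs j) => h; rewrite -coef_map h coef0.
  have cC : countable (\bigcup_(j in [set: nat]) [set x | root (map_poly (e s) (f j)) x]).
    by apply: bigcup_countable => // j _; exact: countable_roots.
  have [|z [z1 z2 hz]] := @interval_avoid R (y i - r) (y i + r) _ _ cC; first by lra.
  exists (s, z); split.
    by split => //=; rewrite ltr_norml; apply/andP; split; lra.
  move=> j; apply/negP => /eqP h; apply: hz; exists j => //=.
  by apply/eqP.
Qed.

Lemma diff_quot_diag p v z : diff_quot p v z z = eval_at (e v) z p^`().
Proof.
rewrite /diff_quot eval_atE (@horner_coef_wide _ (size p).-1); last first.
  by rewrite (leq_trans (size_poly _ _)) // size_poly.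
case: (size p) => [|n]; first by rewrite !big_ord0.
rewrite big_ord_recl big_ord0 mulr0 add0r; apply: eq_bigr => j _ /=.
rewrite coef_map coef_deriv raddfMn /= mulrnAl -mulrnAr; congr (_ * _).
rewrite (eq_bigr (fun=> z ^+ j)) => [|k _].
  by rewrite sumr_const card_ord.
by rewrite -exprD add0n subnK // -ltnS ltn_ord.
Qed.

(** The new coordinate is a simple root of its minimal polynomial, so over a small
    set of values of the previous coordinates it is a continuous function of
    them. *)
Lemma generic_algebraic (p : {poly A}) :
  ~ van (lead_coef p) -> vanp p ->
  (forall q, ~ van (lead_coef q) -> vanp q -> (size p <= size q)%N) ->
  generic e a -> generic (eval_poly e) ay.
Proof.
move=> np vp minp gen.
have nl := vanishesPn UU np.
have nd := vanishesPn UU (algebraic_separable UU np vp minp).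
apply: filterS (filterI gen (filterI vp (filterI nl nd))) => i.
move=> [hi [pi0 [li di]]] O nO.
have [|||W [alpha [nW ai hW]]] := @implicit_root R V
    (fun v z => eval_at (e v) z p) (diff_quot p) (a i) (y i) O _ _ (diff_quotE p)
    (@diff_quot_continuous p _) pi0 _ nO.
- move=> z v; have := @continuous_comp _ _ _ (fun v => (v, z)) (fun u => eval_poly e u p) v.
  by apply; [exact: (cvg_pair cvg_id (cvg_cst _))|exact: eval_poly_continuous].
- move=> v z; have := @continuous_comp _ _ _ (fun z => (v, z)) (fun u => eval_poly e u p) z.
  by apply; [exact: (cvg_pair (cvg_cst _) cvg_id)|exact: eval_poly_continuous].
- by rewrite diff_quot_diag.
have nW' : nbhs (a i) (W `&` [set v | e v (lead_coef p) != 0]).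
  apply: filterI => //. exact: (cvgr_neq0 _ (@ce (lead_coef p) (a i)) li).
have [S [SW Sa starS killS genS]] := hi _ nW'.
exists [set z : V * R | S z.1 /\ z.2 = alpha z.1]; split.
- by move=> [v z] [/= /SW[/hW[_ Ov _] _] ->].
- by [].
- move=> [v z] [/= Sv ->]; have [g [cg g0 g1 Sg]] := starS v Sv.
  exists (fun t => (g t, alpha (g t))); split.
  + have cag : continuous (alpha \o g).
      move=> t; apply: continuous_comp; first exact: cg.
      by have [/hW[]] := SW _ (Sg t).
    by move=> t; exact: (cvg_pair (cg t) (cag t)).
  + by rewrite g0 ai.
  + by rewrite g1.
  + by move=> t; split => //=; exact: Sg.
- move=> [v z] [/= Sv ->] F vF.
  have [/hW[Gv _ _] lv] := SW _ Sv.
  exact: (algebraic_null UU np vp minp vF (killS _ Sv) lv Gv).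
- move=> f nf; have [c hc] := choice (fun j => algebraic_generic UU np vp minp (nf j)).
  have [s [Ss hs]] := genS c (fun j => (hc j).1).
  exists (s, alpha s); split => // j.
  have [/hW[Gv _ _] lv] := SW _ Ss.
  exact: ((hc j).2 (e s) (alpha s) (killS _ Ss) Gv (hs j)).
Qed.

(** The transcendental and the algebraic case exhaust all possibilities, so the
    values [y] of the new coordinate can be arbitrary. *)
Lemma generic_poly : generic e a -> generic (eval_poly e) ay.
Proof.
have [[q [nq vq]]|tr] := pselect (exists q, ~ van (lead_coef q) /\ vanp q).
  pose P n := `[< exists q, [/\ ~ van (lead_coef q), vanp q & size q = n] >].
  have exP : exists n, P n by exists (size q); apply/asboolP; exists q.
  case: (ex_minnP exP) => n /asboolP[p [np vp <-]] minn.
  apply: (generic_algebraic np vp) => r nr vr.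
  by apply: minn; apply/asboolP; exists r.
by apply: generic_transcendental => r nr vr; apply: tr; exists r.
Qed.

End Step.

(** Iterating [generic_poly], starting from a constant family, introduces the
    members of a finite list of arbitrary families as coordinates. *)
Lemma generic_realization (k : nat) (y : nat -> I -> R) :
  exists (A : idomainType) (V : topologicalType)
    (e : V -> {rmorphism A -> R}) (a : I -> V) (c : R -> A) (x : nat -> A),
  [/\ eval_continuous e, generic e a, forall v r, e v (c r) = r &
      forall j, (j < k)%N -> forall i, e (a i) (x j) = y j i].
Proof.
elim: k => [|k [A [V [e [a [c [x [ce gen ec ex]]]]]]]].
  exists R, R, (fun=> idfun), (fun=> 0), id, (fun=> 0).
  split => //; first by move=> p v; exact: cvg_cst.
  apply: filterE => i O nO; exists [set 0]; split => //.
  - by move=> _ ->; exact: nbhs_singleton.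
  - by move=> _ ->; exists (fun=> 0); split => // t; exact: cvg_cst.
  - by move=> s _ p vp; have [j /= hj] := filter_ex vp.
  - move=> f nf; exists 0; split => // j; apply/negP => /eqP fj.
    by apply: (nf j); apply: filterE.
exists {poly A}, (V * R)%type, (eval_poly e), (fun i => (a i, y k i)),
  (fun r => (c r)%:P), (fun j => if j == k then 'X else (x j)%:P); split.
- exact: eval_poly_continuous.
- exact: generic_poly.
- by move=> v r; rewrite /eval_poly eval_atC.
- move=> j; rewrite ltnS leq_eqVlt => /orP[/eqP ->|jk] i.
    by rewrite eqxx /eval_poly eval_atE map_polyX hornerX.
  by rewrite (ltn_eqF jk) /eval_poly eval_atC ex.
Qed.

End GenericFamily.

(** * Words *)

Section Words.
Local Open Scope group_scope.
Variable G : groupType.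

Definition letter_val (l : G * bool) : G := if l.2 then l.1 else l.1^-1.

Definition word_val (w : seq (G * bool)) : G := \prod_(l <- w) letter_val l.

Definition letter_inv (l : G * bool) : G * bool := (l.1, ~~ l.2).

Definition word_over (X : set G) (w : seq (G * bool)) : Prop :=
  forall l, l \in w -> X l.1.

Lemma letter_invV l : letter_val (letter_inv l) = (letter_val l)^-1.
Proof. by case: l => x [] //=; rewrite /letter_val /= invgK. Qed.

Lemma word_val_cat w1 w2 : word_val (w1 ++ w2) = word_val w1 * word_val w2.
Proof. by rewrite /word_val big_cat. Qed.

Lemma word_val_cons l w : word_val (l :: w) = letter_val l * word_val w.
Proof. by rewrite /word_val big_cons. Qed.

Lemma word_val_nil : word_val [::] = 1.
Proof. by rewrite /word_val big_nil. Qed.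

Definition generated (X : set G) : {pred G} :=
  fun g => `[< exists w, word_over X w /\ word_val w = g >].

Lemma generatedP X g :
  reflect (exists w, word_over X w /\ word_val w = g) (g \in generated X).
Proof. exact: asboolP. Qed.

Lemma generated1 X : 1 \in generated X.
Proof. by apply/generatedP; exists [::]; split; rewrite ?word_val_nil. Qed.

Lemma generatedM X : mulg_closed (generated X).
Proof.
move=> _ _ /generatedP[w1 [o1 <-]] /generatedP[w2 [o2 <-]].
apply/generatedP; exists (w1 ++ w2); split; last exact: word_val_cat.
by move=> l; rewrite mem_cat => /orP[/o1|/o2].
Qed.

Lemma generatedV X : invg_closed (generated X).
Proof.
move=> _ /generatedP[w [o <-]]; elim: w o => [|l w IH] o.
  by rewrite word_val_nil invg1; exact: generated1.
rewrite word_val_cons invgM; apply: generatedM.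
  by apply: IH => k kw; apply: o; rewrite inE kw orbT.
apply/generatedP; exists [:: letter_inv l]; split; last first.
  by rewrite word_val_cons word_val_nil mulg1 letter_invV.
by move=> k; rewrite inE => /eqP -> /=; apply: o; rewrite inE eqxx.
Qed.

HB.instance Definition _ X := isMulClosed.Build G (generated X) (@generatedM X).
HB.instance Definition _ X := isMul1Closed.Build G (generated X) (@generated1 X).
HB.instance Definition _ X := isInvClosed.Build G (generated X) (@generatedV X).

Lemma sub_generated (X : set G) x : X x -> x \in generated X.
Proof.
move=> Xx; apply/generatedP; exists [:: (x, true)]; split.
  by move=> l; rewrite inE => /eqP ->.
by rewrite word_val_cons word_val_nil mulg1.
Qed.

Lemma finitely_generated_word : finitely_generated G ->
  exists S : seq G, forall g, exists w, word_over [set` S] w /\ word_val w = g.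
Proof.
case=> S hS; exists S => g; apply/generatedP.
by rewrite (hS (generated [set` S] : groupClosed G)) // => x xS; exact: sub_generated.
Qed.

End Words.

Lemma finitely_generated_countable (G : groupType) :
  finitely_generated G -> countable [set: G].
Proof.
move=> /finitely_generated_word[S hS].
pose f (c : seq (nat * bool)) := word_val [seq (nth 1%g S l.1, l.2) | l <- c].
apply: (@sub_countable _ _ _ [set: seq (nat * bool)]); last exact: countableP.
apply: card_le_trans (card_image_le f _); apply: subset_card_le => g _.
have [w [ow <-]] := hS g.
exists [seq (index l.1 S, l.2) | l <- w] => //.
rewrite /f -map_comp; congr word_val; rewrite -[RHS]map_id.
apply/eq_in_map => -[x b] /ow /= xS; by rewrite nth_index.
Qed.

Definition mk_multiplicative (G H : groupType) (f : G -> H)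
    (fM : {morph f : x y / (x * y)%g}) : {multiplicative G -> H} :=
  HB.pack_for {multiplicative G -> H} f (isMultiplicative.Build G H f fM).

Section MultiplicativeGroups.
Variables (G H : groupType) (f : {multiplicative G -> H}).
Local Open Scope group_scope.

Lemma mult_one : f 1 = 1.
Proof. by apply: (mulgI (f 1)); rewrite -gmulfM !mulg1. Qed.

Lemma mult_inv x : f x^-1 = (f x)^-1.
Proof. by apply: (mulgI (f x)); rewrite -gmulfM !mulgV mult_one. Qed.

End MultiplicativeGroups.

(** * Deforming families of representations *)

Section MatrixFacts.
Variable R : realType.
Implicit Types A B : SL2 R.

Lemma SL2_mx_inj : injective (@SL2_mx R).
Proof. exact: val_inj. Qed.

Lemma SL2_mulE A B : SL2_mx (A * B)%g = SL2_mx A *m SL2_mx B.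
Proof. by []. Qed.

Lemma SL2_1E : SL2_mx (1%g : SL2 R) = 1%:M.
Proof. by []. Qed.

Lemma SL2_invE_adj A : SL2_mx A^-1%g = \adj (SL2_mx A).
Proof.
by rewrite -[LHS]/(invmx (SL2_mx A)) /invmx SL2_unit SL2_det invr1 scale1r.
Qed.

Definition trsq2 A : R := (\tr (SL2_mx A)) ^+ 2.

Definition close (d : R) A B := forall r c, `|SL2_mx A r c - SL2_mx B r c| < d.

Definition rotation A :=
  SL2_mx A 0 0 = SL2_mx A 1 1 /\ SL2_mx A 0 1 = - SL2_mx A 1 0.

Lemma within_clamp (T : topologicalType) (c : R -> T) :
  {within `[0, 1], continuous c} -> continuous (c \o @clamp R).
Proof.
move=> /subspace_continuousP cc u P /= nP.
have cu := clamp_in u.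
have := cc (clamp u); rewrite /= in_itv /= cu => /(_ isT) /(_ P nP) nw.
have nc : nbhs u (@clamp R @^-1` _) := @clamp_continuous R u _ nw.
by apply: filterS nc => t; apply; rewrite /= in_itv /= clamp_in.
Qed.

End MatrixFacts.

(** A homomorphism to the group of paths based at 1 is a path of
    representations starting from the trivial one. *)
Definition path_rep (R : realType) (L : groupType) :=
  {multiplicative L -> based_path R (SL2 R)}.

Definition rep_at (R : realType) (L : groupType) (w : path_rep R L) (g : L)
  (u : R) : SL2 R := path_fun (w g) u.

Section PathRep.
Variables (R : realType) (L : groupType) (w : path_rep R L).
Local Open Scope group_scope.

Lemma rep_atM g h u : rep_at w (g * h) u = rep_at w g u * rep_at w h u.
Proof. by rewrite /rep_at gmulfM. Qed.

Lemma rep_at1 u : rep_at w 1 u = 1.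
Proof. by rewrite /rep_at mult_one. Qed.

Lemma rep_atV g u : rep_at w g^-1 u = (rep_at w g u)^-1.
Proof. by rewrite /rep_at mult_inv. Qed.

End PathRep.

Section Deformation.
Variables (R : realType) (L : groupType).
Hypothesis fgL : finitely_generated L.
Variables (I : Type) (U : set_system I).
Hypothesis UU : UltraFilter U.
Variable w : I -> path_rep R L.

(** The entries of the generators are coordinates, hence so are the entries of
    all elements of the group. *)
Lemma generic_matrices : exists (A : idomainType) (V : topologicalType)
    (e : V -> {rmorphism A -> R}) (a : I -> V) (c : R -> A) (W : L -> 'M[A]_2),
  [/\ eval_continuous e, generic U e a, forall v r, e v (c r) = r &
      forall g i, map_mx (e (a i)) (W g) = SL2_mx (rep_at (w i) g 1)].
Proof.
have [S hS] := finitely_generated_word fgL.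
(* The coordinate number [4 m + 2 r + k] is the entry [(r, k)] of the generator
   number [m]. *)
pose y j i := SL2_mx (rep_at (w i) (nth 1%g S (j %/ 4)) 1) (inord ((j %% 4) %/ 2)) (inord (j %% 2)).
have [A [V [e [a [c [x [ce gen ec ex]]]]]]] := generic_realization UU (4 * size S) y.
have WS s : s \in S -> exists W, forall i, map_mx (e (a i)) W = SL2_mx (rep_at (w i) s 1).
  move=> sS; exists (\matrix_(r, k) x (4 * index s S + (2 * r + k))%N) => i.
  apply/matrixP => r k; rewrite !mxE.
  have hr : (r < 2)%N := ltn_ord r; have hk : (k < 2)%N := ltn_ord k.
  have hi : (index s S < size S)%N by rewrite index_mem.
  rewrite ex; last by lia.
  rewrite /y (_ : (4 * index s S + (2 * r + k)) %/ 4 = index s S)%N; last by lia.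
  rewrite (_ : (4 * index s S + (2 * r + k)) %% 4 %/ 2 = r)%N; last by lia.
  rewrite (_ : (4 * index s S + (2 * r + k)) %% 2 = k)%N; last by lia.
  by rewrite nth_index // !inord_val.
have hW g : exists W, forall i, map_mx (e (a i)) W = SL2_mx (rep_at (w i) g 1).
  have [u [ou <-]] := hS g; elim: u ou => [|[s b] u IH] ou.
    exists 1%:M => i; rewrite map_mx1 word_val_nil.
    by rewrite rep_at1.
  have [|W1 h1] := IH; first by move=> l lu; apply: ou; rewrite inE lu orbT.
  have [|W2 h2] := WS s; first by apply: (ou (s, b)); rewrite inE eqxx.
  have [W3 h3] : exists W3, forall i,
      map_mx (e (a i)) W3 = SL2_mx (rep_at (w i) (letter_val (s, b)) 1).
    case: b {ou}; [exists W2|exists (\adj W2)] => i; first by rewrite h2.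
    by rewrite rep_atV map_mx_adj h2 SL2_invE_adj.
  by exists (W3 *m W1) => i; rewrite map_mxM h1 h3 word_val_cons rep_atM SL2_mulE.
have [W {}hW] := choice hW.
by exists A, V, e, a, c, W; split.
Qed.

(** The entries of the matrices [w i g 1] are functions of a generic family of
    points. The group relations hold along the ultrafilter, so all points of the
    path connected set next to some [a i] are representations, and one of these
    points meets the countably many conditions. A path from [a i] to this point
    prolongs the path of representations that ends at [w i]. *)
Theorem deformation (Y : set (L * R)) :
  countable Y ->
  (forall g x, Y (g, x) -> U [set i | trsq2 (rep_at (w i) g 1) != x]) ->
  exists i, forall d g1 g2, 0 < d ->
  exists rho : path_rep R L,
    [/\ forall g x, Y (g, x) -> trsq2 (rep_at rho g 1) != x,
        close d (rep_at rho g1 1) (rep_at (w i) g1 1), close d (rep_at rho g2 1) (rep_at (w i) g2 1) &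
        forall g, (forall j, rotation (rep_at (w j) g 1)) -> rotation (rep_at rho g 1)].
Proof.
move=> cY hY; have [A [V [e [a [c [W [ce gen ec eW]]]]]]] := generic_matrices.
have [i hi] := filter_ex gen; exists i => d g1 g2 d0.
pose ea j := e (a j).
have van p : (forall j, e (a j) p = 0) -> vanishes U ea p.
  by move=> h; apply: filterE.
have nclose g : nbhs (a i) [set v | forall r k, `|e v (W g r k) - SL2_mx (rep_at (w i) g 1) r k| < d].
  apply: filter_forall => r; apply: filter_forall => k.
  have := ce (W g r k) (a i); move/cvgrPdist_lt => /(_ d d0).
  rewrite -eW mxE; apply: filterS => v; by rewrite distrC.
have [S [SO Sa starS killS genS]] := hi _ (filterI (nclose g1) (nclose g2)).
pose F (q : L * R) := \tr (W q.1) ^+ 2 - c q.2.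
have Fe v q : e v (F q) = (\tr (map_mx (e v) (W q.1))) ^+ 2 - q.2.
  by rewrite rmorphB rmorphXn ec trace_map_mx.
have nF q : Y q -> ~ vanishes U ea (F q).
  case: q => g x /hY h; apply: (nvanishes UU); apply: filterS h => j /= h.
  by rewrite Fe /= eW subr_eq0.
have [s [Ss hs]] : exists s, S s /\ forall q, Y q -> e s (F q) != 0.
  have [Y0|[f]] := pfcard_geP cY; first by exists (a i); split => // q; rewrite Y0.
  have [|s [Ss hs]] := genS (fun n => F (f n)).
    by move=> n; apply: nF; exact: (@funS _ _ _ _ f).
  exists s; split => // q /(@surj _ _ _ _ f)[n _ <-]; exact: hs.
(* The relations [det = 1] and [W (g h) = W g W h] hold at all points [a j], so
   they hold on [S]; this turns the points of [S] into representations. *)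
have detW v g : S v -> \det (map_mx (e v) (W g)) = 1.
  move=> /killS kv; apply/eqP; rewrite -subr_eq0 det_map_mx -(rmorph1 (e v)) -rmorphB.
  by apply/eqP/kv/van => j; rewrite rmorphB rmorph1 -det_map_mx eW SL2_det subrr.
have mulW v g h : S v ->
    map_mx (e v) (W (g * h)%g) = map_mx (e v) (W g) *m map_mx (e v) (W h).
  move=> /killS kv; rewrite -map_mxM; apply/matrixP => r k; rewrite !mxE.
  apply/eqP; rewrite -subr_eq0 -rmorphB; apply/eqP/kv/van => j.
  have := congr1 (fun M : 'M_2 => M r k) (map_mxM (e (a j)) (W g) (W h)).
  rewrite !eW -SL2_mulE -rep_atM -(eW (g * h)%g j) !mxE.
  by rewrite rmorphB => ->; rewrite subrr.
pose rho v g : SL2 R := insubd (1%g : SL2 R) (map_mx (e v) (W g)).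
have rhoE v g : S v -> SL2_mx (rho v g) = map_mx (e v) (W g).
  by move=> Sv; rewrite [LHS]val_insubd detW // eqxx.
have rhoM v g h : S v -> rho v (g * h)%g = (rho v g * rho v h)%g.
  by move=> Sv; apply: SL2_mx_inj; rewrite SL2_mulE !rhoE // mulW.
have rhoa g : rho (a i) g = rep_at (w i) g 1.
  by apply: SL2_mx_inj; rewrite rhoE // eW.
have [gam [cgam gam0 gam1 Sgam]] := starS s Ss.
(* First the given path up to [w i], then the path in [S]: as a product of three
   factors the concatenation is visibly continuous. *)
pose path g u := (rep_at (w i) g (clamp (2 * u)) * (rep_at (w i) g 1)^-1 * rho (gam (clamp (2 * u - 1))) g)%g.
have path_lo g u : u <= 1 / 2 -> path g u = rep_at (w i) g (clamp (2 * u)).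
  move=> u1; rewrite /path [clamp (2 * u - 1)]clamp_le0; last by lra.
  by rewrite gam0 rhoa mulgVK.
have path_hi g u : 1 / 2 <= u -> path g u = rho (gam (clamp (2 * u - 1))) g.
  by move=> u1; rewrite /path [clamp (2 * u)]clamp_ge1 ?mulgV ?mul1g //; lra.
have path1 g : path g 1 = rho s g.
  by rewrite path_hi ?[clamp _]clamp_ge1 ?gam1 //; lra.
have lin_cont (b : R) : continuous (fun u : R => clamp (2 * u - b)).
  have c2 : continuous (fun u : R => 2 * u - b).
    move=> u; apply: cvgB; last exact: cvg_cst.
    by apply: cvgM; [exact: cvg_cst|exact: cvg_id].
  by move=> u; exact: (continuous_comp (c2 u) (@clamp_continuous R _)).
have path_ok g : is_based_path (path g).
  have [w0 cw] := based_pathP (w i g).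
  split; first by rewrite path_lo ?mulr0 ?clamp_le0 //; lra.
  apply: continuous_subspaceT; apply: continuousMg; [apply: continuousMg|].
  - have -> : (fun u => rep_at (w i) g (clamp (2 * u))) = (path_fun (w i g) \o @clamp R) \o (fun u => 2 * u).
      by [].
    move=> u; apply: continuous_comp; last exact: (within_clamp cw).
    by apply: cvgM; [exact: cvg_cst|exact: cvg_id].
  - by move=> u; exact: cvg_cst.
  - apply: SL2_continuous => r k.
    rewrite (_ : (fun u => _) = (fun v => e v (W g r k)) \o (gam \o (fun u => clamp (2 * u - 1)))).
      move=> u; apply: continuous_comp; last exact: ce.
      by apply: continuous_comp; [exact: lin_cont|exact: cgam].
    by apply/funext => u; rewrite rhoE ?mxE.
pose P g : based_path R (SL2 R) := mk_based_path (path_ok g).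
have PM : {morph P : g h / (g * h)%g}.
  move=> g h; apply: path_ext => u.
  rewrite -[RHS]/(path g u * path h u)%g -[LHS]/(path (g * h)%g u).
  have [u1|u1] := leP u (1 / 2); last by rewrite !path_hi ?rhoM // ltW.
  rewrite !path_lo //.
  exact: rep_atM.
exists (mk_multiplicative PM).
have E1 g : rep_at (mk_multiplicative PM) g 1 = rho s g by exact: path1.
split.
- move=> g x Yg; rewrite E1 /trsq2 rhoE //.
  by have := hs _ Yg; rewrite Fe /= subr_eq0.
- move=> r k; rewrite E1 rhoE // mxE.
  by have [h _] := SO s Ss; exact: h.
- move=> r k; rewrite E1 rhoE // mxE.
  by have [_ h] := SO s Ss; exact: h.
- move=> g rg; rewrite E1 /rotation rhoE // !mxE.
  have ks := killS s Ss; split; apply/eqP.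
    rewrite -subr_eq0 -rmorphB; apply/eqP/ks/van => j; rewrite rmorphB.
    by have [+ _] := rg j; rewrite -eW !mxE => ->; rewrite subrr.
  rewrite -subr_eq0 -rmorphN -rmorphB; apply/eqP/ks/van => j; rewrite rmorphB rmorphN.
  by have [_] := rg j; rewrite -eW !mxE => ->; rewrite subrr.
Qed.

End Deformation.

(** * Free groups *)

Section GeneratedSubgroup.
Local Open Scope group_scope.
Variables (G : groupType) (X : set G).

Definition subgroup := {g : G | g \in generated X}.
HB.instance Definition _ := [isSub of subgroup for sval].
HB.instance Definition _ := [Choice of subgroup by <:].
Implicit Types x y z : subgroup.

Definition sub_one : subgroup := exist _ 1 (generated1 X).
Definition sub_mul x y : subgroup :=
  exist _ (val x * val y) (generatedM (valP x) (valP y)).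
Definition sub_inv x : subgroup := exist _ (val x)^-1 (generatedV (valP x)).

Lemma sub_mulA : associative sub_mul.
Proof. by move=> x y z; apply: val_inj; exact: mulgA. Qed.
Lemma sub_mul1g : left_id sub_one sub_mul.
Proof. by move=> x; apply: val_inj; exact: mul1g. Qed.
Lemma sub_mulg1 : right_id sub_one sub_mul.
Proof. by move=> x; apply: val_inj; exact: mulg1. Qed.
Lemma sub_mulVg : left_inverse sub_one sub_inv sub_mul.
Proof. by move=> x; apply: val_inj; exact: mulVg. Qed.
Lemma sub_mulgV : right_inverse sub_one sub_inv sub_mul.
Proof. by move=> x; apply: val_inj; exact: mulgV. Qed.

HB.instance Definition _ := isGroup.Build subgroup
  sub_mulA sub_mul1g sub_mulg1 sub_mulVg sub_mulgV.

End GeneratedSubgroup.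

Section Free.
Variables (F : groupType) (X : set F).
Local Open Scope group_scope.

(** The uniqueness half of the universal property: the identity and the
    retraction of [F] onto the subgroup generated by [X] agree on [X]. *)
Lemma free_on_generated : free_on X ->
  forall g, exists w, word_over X w /\ word_val w = g.
Proof.
move=> frX g.
pose f (x : F) : subgroup X := insubd (sub_one X) x.
have [phi [phiX _]] := frX (subgroup X) f.
have [psi [_ uniq]] := frX F idfun.
have vM : {morph (fun x => val (phi x)) : x y / x * y}.
  by move=> x y; rewrite gmulfM.
have iM : {morph (fun x : F => x) : x y / x * y} by [].
have e1 : mk_multiplicative vM =1 psi.
  apply: uniq => x Xx; rewrite -[LHS]/(val (phi x)) phiX //.
  exact: (insubdK (sub_one X) (sub_generated Xx)).
have e2 : mk_multiplicative iM =1 psi by apply: uniq.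
apply/generatedP; have : val (phi g) = g.
  by rewrite -[LHS]/(mk_multiplicative vM g) e1 -e2.
by move=> <-; exact: (valP (phi g)).
Qed.

Definition noncancel (l m : F * bool) := m != letter_inv l.

Lemma letter_inv_mul (l : F * bool) : letter_val l * letter_val (letter_inv l) = 1.
Proof. by rewrite letter_invV mulgV. Qed.

Lemma not_reduced (w : seq (F * bool)) : ~~ sorted noncancel w ->
  exists w1 l w2, w = w1 ++ l :: letter_inv l :: w2.
Proof.
elim: w => [//|l [//|m w] IH] /=; have [lm|] := boolP (noncancel l m).
  move=> /IH[w1 [k [w2 ->]]]; by exists (l :: w1), k, w2.
by rewrite negbK => /eqP -> _; exists [::], l, w.
Qed.

(** A shortest word among those whose value is conjugate to [h] is cyclically
    reduced. *)
Lemma cyclically_reduced h : (forall g, exists w, word_over X w /\ word_val w = g) ->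
  h <> 1 -> exists l s g, [/\ word_over X (l :: s),
    word_val (l :: s) = g^-1 * h * g, path noncancel l s & noncancel (last l s) l].
Proof.
move=> genX h1.
pose P n := `[< exists w g, [/\ word_over X w, word_val w = g^-1 * h * g & size w = n] >].
have exP : exists n, P n.
  have [w [ow hw]] := genX h; exists (size w); apply/asboolP; exists w, 1.
  by split; rewrite // invg1 mul1g mulg1.
case: (ex_minnP exP) => n /asboolP[w [g [ow hw sw]]] minn.
have {}minn w' g' : word_over X w' -> word_val w' = g'^-1 * h * g' ->
    (size w <= size w')%N.
  by move=> ow' hw'; rewrite sw; apply: minn; apply/asboolP; exists w', g'.
case: w => [|l s] in ow hw sw minn *.
  case: h1; have -> : h = g * (g^-1 * h * g) * g^-1.
    by rewrite !mulgA mulgV mul1g mulgK.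
  by rewrite -hw word_val_nil mulg1 mulgV.
exists l, s, g; split => //.
  apply: contraT => /(@not_reduced (l :: s))[w1 [k [w2 E]]].
  suff: (size (l :: s) <= size (w1 ++ w2))%N.
    by rewrite E !size_cat /= !addnS ltnNge leqnSn.
  apply: (minn _ g).
  - move=> m; rewrite mem_cat => mw; apply: ow; rewrite E mem_cat !inE.
    by case/orP: mw => ->; rewrite ?orbT.
  - rewrite -hw E !word_val_cat !word_val_cons.
    by rewrite [X in _ = _ * X]mulgA letter_inv_mul mul1g.
apply: contraT; rewrite negbK => /eqP E.
case/lastP: s => [|s m] in ow hw sw minn E *.
  by case: l E {ow hw sw minn} => x [].
move: E; rewrite last_rcons => E.
suff: (size (l :: rcons s m) <= size s)%N.
  by rewrite /= size_rcons ltnNge ltnW.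
apply: (minn _ (g * letter_val l)).
- by move=> k ks; apply: ow; rewrite inE mem_rcons inE ks !orbT.
- have := hw; rewrite word_val_cons -cats1 word_val_cat word_val_cons word_val_nil mulg1 => hw'.
  rewrite invgM -!mulgA (mulgA g^-1) (mulgA (g^-1 * h)) -hw' E letter_invV.
  by rewrite !mulgA mulVg mul1g mulgK.
Qed.

End Free.

(** * Paths of Schottky representations *)

Section RankOne.
Variable R : realType.
Implicit Types a b c d t : R.

Definition mx2 (a b c d : R) : 'M[R]_2 :=
  \matrix_(r, k) (if r == 0 then (if k == 0 then a else b)
                  else (if k == 0 then c else d)).

Lemma ord2P (r : 'I_2) : r = 0 \/ r = 1.
Proof. by case: r => -[|[|//]] hr; [left|right]; apply: val_inj. Qed.

Lemma mx2E (M : 'M[R]_2) : M = mx2 (M 0 0) (M 0 1) (M 1 0) (M 1 1).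
Proof.
by apply/matrixP => r k; rewrite mxE; case: (ord2P r) => ->; case: (ord2P k) => ->.
Qed.

Lemma mul_mx2 a b c d a' b' c' d' : mx2 a b c d *m mx2 a' b' c' d' =
  mx2 (a * a' + b * c') (a * b' + b * d') (c * a' + d * c') (c * b' + d * d').
Proof.
apply/matrixP => r k; rewrite !mxE big_ord_recl big_ord1 !mxE.
by case: (ord2P r) => ->; case: (ord2P k) => ->.
Qed.

Lemma det_mx2 a b c d : \det (mx2 a b c d) = a * d - b * c.
Proof.
rewrite (expand_det_row _ 0) big_ord_recl big_ord1 /cofactor !det_mx11 !mxE /=.
by rewrite addn0 addn1 expr0 expr1 mul1r mulN1r mulrN.
Qed.

Lemma tr_mx2 a b c d : \tr (mx2 a b c d) = a + d.
Proof. by rewrite /mxtrace big_ord_recl big_ord1 !mxE. Qed.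

(** The rank one matrix with column space spanned by [(1, a)] and kernel
    spanned by [(1, b)]. *)
Definition rk1 a b : 'M[R]_2 := mx2 (- b) 1 (- (a * b)) a.

Lemma rk1_mul a b c d : rk1 a b *m rk1 c d = (c - b) *: rk1 a d.
Proof.
rewrite mul_mx2; apply/matrixP => r k; rewrite !mxE.
by case: (ord2P r) => ->; case: (ord2P k) => -> /=; ring.
Qed.

Lemma rk1_tr a b : \tr (rk1 a b) = a - b.
Proof. by rewrite tr_mx2 addrC. Qed.

Definition proj a b : 'M[R]_2 := (a - b)^-1 *: rk1 a b.

(** The hyperbolic element with eigenvalues [t] on [(1, a)] and [t^-1] on
    [(1, b)]. *)
Definition hyp a b t : 'M[R]_2 := t *: proj a b + t^-1 *: proj b a.

Lemma hypE a b t : a != b -> t != 0 -> hyp a b t = (a - b)^-1 *: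
   mx2 (t^-1 * a - t * b) (t - t^-1) (- (a * b) * (t - t^-1)) (t * a - t^-1 * b).
Proof.
move=> ab t0; apply/matrixP => r k; rewrite !mxE.
by case: (ord2P r) => ->; case: (ord2P k) => -> /=; field; rewrite t0 !subr_eq0 ab eq_sym ab.
Qed.

Lemma hyp_det a b t : a != b -> t != 0 -> \det (hyp a b t) = 1.
Proof.
by move=> ab t0; rewrite hypE // detZ det_mx2; field; rewrite t0 subr_eq0.
Qed.

Lemma hyp_inv a b t : a != b -> t != 0 -> hyp a b t *m hyp b a t = 1%:M.
Proof.
move=> ab t0; rewrite !hypE // 1?eq_sym // -scalemxAl -scalemxAr scalerA mul_mx2.
apply/matrixP => r k; rewrite !mxE.
by case: (ord2P r) => ->; case: (ord2P k) => -> /=; field; rewrite t0 !subr_eq0 ab eq_sym ab.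
Qed.

Lemma hyp1 a b : a != b -> hyp a b 1 = 1%:M.
Proof.
move=> ab; rewrite !hypE ?oner_neq0 //; apply/matrixP => r k; rewrite !mxE.
by case: (ord2P r) => ->; case: (ord2P k) => -> /=; field; rewrite subr_eq0.
Qed.

(** The matrix [t *: hyp a b t], as a polynomial in ['X = t ^+ 2]. *)
Definition polyhyp a b : 'M[{poly R}]_2 :=
  'X *: map_mx polyC (proj a b) + map_mx polyC (proj b a).

Lemma polyhyp_eval a b t : t != 0 ->
  map_mx (horner_eval (t ^+ 2)) (polyhyp a b) = t *: hyp a b t.
Proof.
move=> t0; apply/matrixP => r k.
rewrite !mxE /horner_eval hornerD hornerM hornerX !hornerC.
by rewrite mulrDr mulrA -expr2 (mulrA t t^-1) divff // mul1r.
Qed.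

End RankOne.

Section WordMatrices.
Variables (R : realType) (T : eqType).

Definition word_mx (K : pzSemiRingType) (f : T -> 'M[K]_2) (w : seq T) :=
  foldr (fun l M => f l *m M) 1%:M w.

Variables (c c' : T -> R).

Let E l := proj (c l) (c' l).
Let P l := polyhyp (c l) (c' l).

Definition word_poly w := \tr (word_mx P w).

Lemma word_poly_eval w t : t != 0 -> (word_poly w).[t ^+ 2] =
  t ^+ size w * \tr (word_mx (fun l => hyp (c l) (c' l) t) w).
Proof.
move=> t0; rewrite -[LHS]/(horner_eval (t ^+ 2) (word_poly w)) -trace_map_mx -mxtraceZ.
congr (\tr _); elim: w => [|l w IH] /=; first by rewrite map_mx1 scale1r.
by rewrite map_mxM IH polyhyp_eval // exprS -scalemxAr -scalemxAl scalerA mulrC.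
Qed.

(** The top coefficient of the product only sees the projections onto the
    expanding directions. *)
Lemma word_mx_coef w r k j : ((size w < j)%N -> (word_mx P w r k)`_j = 0) /\
  (word_mx P w r k)`_(size w) = word_mx E w r k.
Proof.
elim: w r k j => [|l w IH] r k j /=.
  rewrite !mxE; split; first by case: j => // j _; rewrite coefMn coef1 mul0rn.
  by rewrite coefMn coef1.
have cf i : (word_mx P (l :: w) r k)`_i.+1 =
    \sum_(m < 2) (E l r m * (word_mx P w m k)`_i
                  + proj (c' l) (c l) r m * (word_mx P w m k)`_i.+1).
  rewrite /= mxE coef_sum; apply: eq_bigr => m _.
  by rewrite !mxE mulrDl coefD -mulrA coefXM /= !coefCM.
split.
  case: j => // j; rewrite ltnS => hj; rewrite -/(word_mx P (l :: w)) cf big1 // => m _.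
  have [-> //] := IH m k j; have [-> //] := IH m k j.+1; first by rewrite !mulr0 addr0.
  by rewrite ltnW.
rewrite -/(word_mx P (l :: w)) cf [RHS]mxE; apply: eq_bigr => m _.
have [_ ->] := IH m k 0%N; have [-> //] := IH m k (size w).+1.
by rewrite mulr0 addr0.
Qed.

(** A product of rank one projections vanishes only if the image of one of them
    is the kernel of the preceding one. *)
Lemma word_mx_rk1 l s :
  all (fun m => c m != c' m) (l :: s) ->
  path (fun l m => c m != c' l) l s ->
  exists2 k, k != 0 & word_mx E (l :: s) = k *: rk1 (c l) (c' (last l s)).
Proof.
elim: s l => [|m s IH] l.
  rewrite /= andbT => cl _; exists (c l - c' l)^-1; last by rewrite mulmx1.
  by rewrite invr_eq0 subr_eq0.
rewrite [all _ _]/= => /andP[cl cs] /= /andP[lm ps].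
have [k k0 h] := IH m cs ps.
exists ((c l - c' l)^-1 * k * (c m - c' l)).
  by rewrite !mulf_neq0 ?invr_eq0 ?subr_eq0.
rewrite -[LHS]/(E l *m word_mx E (m :: s)) h /E /proj.
by rewrite -scalemxAl -scalemxAr rk1_mul !scalerA.
Qed.

Lemma word_poly_size l s :
  all (fun m => c m != c' m) (l :: s) ->
  path (fun l m => c m != c' l) l s -> c l != c' (last l s) ->
  size (word_poly (l :: s)) = (size s).+2.
Proof.
move=> cw pw cl; have [k k0 h] := word_mx_rk1 cw pw.
have coefT j : (word_poly (l :: s))`_j = \sum_(m < 2) (word_mx P (l :: s) m m)`_j.
  by rewrite /word_poly /mxtrace coef_sum.
apply/anti_leq/andP; split.
  apply/leq_sizeP => j hj; rewrite coefT big1 // => m _.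
  by have [-> //] := word_mx_coef (l :: s) m m j.
rewrite ltnNge; apply/negP => /leq_sizeP /(_ (size s).+1 (leqnn _)).
rewrite coefT (eq_bigr (fun m => word_mx E (l :: s) m m)); last first.
  by move=> m _; have [_] := word_mx_coef (l :: s) m m 0.
rewrite -/(mxtrace _) h mxtraceZ rk1_tr => /eqP.
by rewrite mulf_eq0 (negPf k0) subr_eq0 (negPf cl).
Qed.

End WordMatrices.

Section FreePaths.
Variables (R : realType) (F : groupType) (X : set F).
Hypothesis frX : free_on X.

Section Index.
Variable n : F -> nat.

(** The attracting fixed point of a letter: distinct letters over distinctly
    numbered generators get distinct integers. *)
Definition fixpt (l : F * bool) : R := (2 * n l.1 + l.2)%:R.

Local Notation fixpt' := (fun l => fixpt (letter_inv l)).

Lemma fixpt_neq l : fixpt l != fixpt' l.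
Proof. by case: l => x b; rewrite /fixpt eqr_nat /=; case: b; lia. Qed.

Lemma fixpt_inj l m : fixpt l = fixpt m -> n l.1 = n m.1 /\ l.2 = m.2.
Proof.
move/eqP; rewrite /fixpt eqr_nat => /eqP.
by case: l m => x [] [y []] /=; split => //; lia.
Qed.

Definition hyp_path_fun (x : F) (u : R) : SL2 R :=
  insubd (1%g : SL2 R) (hyp (fixpt (x, true)) (fixpt (x, false)) (expR u)).

Lemma hyp_path_funE x u : SL2_mx (hyp_path_fun x u) =
  hyp (fixpt (x, true)) (fixpt (x, false)) (expR u).
Proof.
have d : fixpt (x, true) != fixpt (x, false) := fixpt_neq (x, true).
have t0 : expR u != 0 by rewrite gt_eqF // expR_gt0.
by rewrite [LHS]val_insubd hyp_det // eqxx.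
Qed.

Lemma hyp_path_based x : is_based_path (hyp_path_fun x).
Proof.
split.
  by apply: SL2_mx_inj; rewrite hyp_path_funE expR0 hyp1 // (fixpt_neq (x, true)).
apply: continuous_subspaceT; apply: SL2_continuous => r k.
rewrite (_ : (fun u => _) = fun u =>
    expR u * proj (fixpt (x, true)) (fixpt (x, false)) r k +
    expR (- u) * proj (fixpt (x, false)) (fixpt (x, true)) r k).
  move=> u; apply: cvgD; apply: cvgM; try exact: cvg_cst.
    exact: continuous_expR.
  have cN : continuous (fun u : R => - u) by move=> v; exact: opp_continuous.
  exact: (continuous_comp (cN u) (@continuous_expR R _)).
by apply/funext => u; rewrite hyp_path_funE expRN /hyp 2![in LHS]mxE [X in _ + X]mxE.
Qed.

(** The generators move along one-parameter groups of hyperbolic elements, and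
    [n] numbers the generators whose fixed points have to be distinct. *)
Lemma free_path_rep : exists phi : path_rep R F, forall w u, word_over X w ->
  SL2_mx (rep_at phi (word_val w) u) =
  word_mx (fun l => hyp (fixpt l) (fixpt' l) (expR u)) w.
Proof.
have [phi [phiX _]] := frX (fun x => mk_based_path (hyp_path_based x)).
exists phi => w u; elim: w => [|l w IH] ow.
  by rewrite word_val_nil rep_at1.
rewrite word_val_cons rep_atM SL2_mulE IH => [|k kw]; last first.
  by apply: ow; rewrite inE kw orbT.
rewrite -[RHS]/(hyp (fixpt l) (fixpt' l) (expR u) *m _); congr (_ *m _).
have Xl : X l.1 by apply: ow; rewrite inE eqxx.
have t0 : expR u != 0 by rewrite gt_eqF // expR_gt0.
have E : SL2_mx (rep_at phi l.1 u) = hyp (fixpt (l.1, true)) (fixpt (l.1, false)) (expR u).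
  by rewrite /rep_at phiX // -hyp_path_funE.
case: l E {ow Xl} => x [] //= E; rewrite /letter_val /letter_inv /=.
rewrite rep_atV; set A := rep_at phi x u in E *.
have : SL2_mx A^-1%g *m SL2_mx A = 1%:M by rewrite -SL2_mulE mulVg.
rewrite E => /(congr1 (mulmx^~ (hyp (fixpt (x, false)) (fixpt (x, true)) (expR u)))).
by rewrite -mulmxA hyp_inv ?mulmx1 ?mul1mx // (fixpt_neq (x, true)).
Qed.

End Index.

Lemma trace_conj (phi : path_rep R F) (h g : F) u :
  \tr (SL2_mx (rep_at phi (g^-1 * h * g)%g u)) = \tr (SL2_mx (rep_at phi h u)).
Proof.
rewrite !rep_atM rep_atV !SL2_mulE -mulmxA mxtrace_mulC -mulmxA -SL2_mulE.
by rewrite mulgV mulmx1.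
Qed.

(** Along these paths the trace of [h] is a Laurent polynomial in [expR u]
    whose degree is the length of a cyclically reduced conjugate of [h]. *)
Lemma free_trace_poly (H0 : seq F) : (forall h, h \in H0 -> h <> 1%g) ->
  exists phi : path_rep R F, forall h, h \in H0 ->
  exists (T : {poly R}) (m : nat), [/\ (0 < m)%N, size T = m.+1 &
    forall u, T.[expR u ^+ 2] = expR u ^+ m * \tr (SL2_mx (rep_at phi h u))].
Proof.
move=> H01; have genX := free_on_generated frX.
have red h : exists ls : (F * bool) * seq (F * bool), h \in H0 -> exists g,
    [/\ word_over X (ls.1 :: ls.2), word_val (ls.1 :: ls.2) = (g^-1 * h * g)%g,
        path (@noncancel F) ls.1 ls.2 & noncancel (last ls.1 ls.2) ls.1].
  have [hH|hH] := boolP (h \in H0); last by exists ((h, true), [::]).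
  have [l [s [g hg]]] := cyclically_reduced genX (H01 h hH).
  by exists (l, s) => _; exists g.
have [ls hls] := choice red.
pose gens := flatten [seq [seq l.1 | l <- (ls h).1 :: (ls h).2] | h <- H0].
pose n x := index x gens.
have [phi hphi] := free_path_rep n; exists phi => h hH.
have [g [ow E pw cw]] := hls h hH; move: ow E pw cw.
case Els: (ls h) => [l s] /= ow E pw cw.
have inG k : k \in l :: s -> k.1 \in gens.
  move=> ks; apply/flattenP; exists [seq l.1 | l <- l :: s].
    by apply/mapP; exists h => //; rewrite Els.
  exact: map_f.
have nonc k m : k \in l :: s -> m \in l :: s -> noncancel k m ->
    fixpt n m != fixpt n (letter_inv k).
  move=> /inG kG /inG mG; apply: contra => /eqP /fixpt_inj[/= nm bm].
  apply/eqP; rewrite [m]surjective_pairing bm; congr (_, _).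
  by move/(congr1 (nth 1%g gens)): nm; rewrite !nth_index.
have lw : l \in l :: s by rewrite inE eqxx.
have lasts : last l s \in l :: s by exact: mem_last.
exists (word_poly (fixpt n) (fun l => fixpt n (letter_inv l)) (l :: s)), (size s).+1.
split => //.
  apply: word_poly_size.
  - by apply/allP => k _; exact: fixpt_neq.
  - by apply: (sub_in_path (P := mem (l :: s)) nonc) pw; exact/allP.
  - exact: nonc.
move=> u; rewrite word_poly_eval ?gt_eqF ?expR_gt0 //; congr (_ * _).
by rewrite -(hphi _ u ow) E trace_conj.
Qed.

End FreePaths.

(** * Levels of the squared trace *)

Section TraceLevels.
Variables (R : realType).
Implicit Types (T : {poly R}) (m : nat).

Lemma size_trace_level T m (x : R) : (0 < m)%N -> size T = m.+1 ->
  size (T ^+ 2 - x *: 'X^m) = (2 * m).+1 /\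
  lead_coef (T ^+ 2 - x *: 'X^m) = lead_coef T ^+ 2.
Proof.
move=> m0 sT; have T0 : T != 0 by rewrite -size_poly_eq0 sT.
have sT2 : size (T ^+ 2) = (2 * m).+1.
  by rewrite expr2 size_mul // sT; lia.
have lt : (size (- (x *: 'X^m)) < size (T ^+ 2))%N.
  rewrite size_polyN sT2 ltnS (leq_trans (size_scale_leq _ _)) // size_polyXn; lia.
by rewrite size_polyDl // lead_coefDl // lead_coef_exp.
Qed.

Variable tr : R -> R.
Variables (T : {poly R}) (m : nat).
Hypotheses (m0 : (0 < m)%N) (sT : size T = m.+1).
Hypothesis trT : forall u, T.[expR u ^+ 2] = expR u ^+ m * tr u.

Let level x := T ^+ 2 - x *: 'X^m.

Lemma level_eval x u :
  (level x).[expR u ^+ 2] = (expR u ^+ 2) ^+ m * (tr u ^+ 2 - x).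
Proof.
rewrite /level hornerD hornerN hornerZ hornerXn horner_exp trT exprMn -!exprM.
by rewrite [(m * 2)%N]mulnC; ring.
Qed.

(** A level of the squared trace consists of the logarithms of the roots of a
    nonzero polynomial: its degree [2 m] comes from [T ^+ 2], because the
    trace grows. *)
Lemma level_countable x : countable [set u | tr u ^+ 2 = x].
Proof.
have [sl _] := size_trace_level x m0 sT.
have l0 : level x != 0 by rewrite -size_poly_eq0 sl.
apply: sub_countable (countable_roots l0).
apply: card_le_trans (card_image_le (fun y => ln y / 2) _).
apply: subset_card_le => u /= hu; exists (expR u ^+ 2).
  by rewrite /= /root level_eval hu subrr mulr0.
by rewrite -expRM_natl expRK mulrC mulKf ?pnatr_eq0.
Qed.

Lemma trace_large : exists u0, forall u, u0 <= u -> 4 < tr u ^+ 2.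
Proof.
have [sl ll] := size_trace_level 4 m0 sT.
have T0 : T != 0 by rewrite -size_poly_eq0 sT.
have lp : 0 < lead_coef (level 4) by rewrite ll exprn_even_gt0 //= lead_coef_eq0.
have [n hn] := poly_pinfty_gt_lc lp.
exists `|n| => u nu.
have eu : n <= expR u ^+ 2.
  have h1 : `|n| <= expR u by rewrite (le_trans nu) // (le_trans _ (expR_ge1Dx u)) // lerDr.
  have h2 : 1 <= expR u.
    by rewrite (le_trans _ (expR_ge1Dx u)) // lerDl (le_trans _ nu).
  by rewrite (le_trans (ler_norm n)) // (le_trans h1) // expr2 ler_peMl // (le_trans _ h2).
have := lt_le_trans lp (hn _ eu).
by rewrite level_eval pmulr_rgt0 ?subr_gt0 // !exprn_gt0 // expR_gt0.
Qed.

End TraceLevels.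

(** Pull back paths of Schottky representations by a homomorphism to a free group
    that is injective on [1] and [Q]. *)
Lemma fully_residually_free_path_rep (R : realType) (L : groupType) (Q : seq L) :
  fully_residually_free L ->
  exists phi : path_rep R L, forall g, g \in Q -> g <> 1%g ->
    (forall x, countable [set u | trsq2 (rep_at phi g u) = x]) /\
    (exists u0, forall u, u0 <= u -> 4 < trsq2 (rep_at phi g u)).
Proof.
move=> frL; have [F [[X frX] [f finj]]] := frL [set` 1%g :: Q] (finite_seq _).
pose H0 := [seq f g | g <- Q & g != 1%g].
have [|phi hphi] := @free_trace_poly R F X frX H0.
  move=> _ /mapP[g + ->]; rewrite mem_filter => /andP[/eqP g1 gQ] fg; apply: g1.
  apply: finj; rewrite ?inE /= ?inE ?eqxx ?gQ ?orbT //.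
  by rewrite fg mult_one.
have psiM : {morph (fun g => phi (f g)) : x y / (x * y)%g}.
  by move=> x y; rewrite !gmulfM.
exists (mk_multiplicative psiM) => g gQ /eqP g1.
have [|T [m [m0 sT trT]]] := hphi (f g).
  by apply/mapP; exists g => //; rewrite mem_filter g1.
have E u : rep_at (mk_multiplicative psiM) g u = rep_at phi (f g) u by [].
split=> [x|].
  exact: (level_countable m0 sT trT x).
exact: (trace_large m0 sT trT).
Qed.

Section SmallRepresentations.
Variables (R : realType) (L : groupType).

Lemma avoid_levels (phi : R -> L -> R) (s : seq (L * R)) (a b : R) : a < b ->
  (forall q, q \in s -> q.1 <> 1%g ->
     countable [set u | a < u < b /\ phi u q.1 = q.2]) ->
  exists u, [/\ a < u, u < b &
    forall g x, (g, x) \in s -> g <> 1%g -> phi u g != x].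
Proof.
move=> ab cs.
pose C := \bigcup_(q in [set q | q \in s /\ q.1 <> 1%g])
  [set u | a < u < b /\ phi u q.1 = q.2].
have cC : countable C.
  apply: bigcup_countable => [|q [qs q1]]; last exact: cs.
  apply: sub_countable (finite_set_countable (finite_seq s)).
  by apply: subset_card_le => q [].
have [u [au ub nC]] := interval_avoid ab cC.
exists u; split => // g x gx g1; apply/eqP => h; apply: nC.
by exists (g, x) => //=; rewrite au ub.
Qed.

(** Stopping early along a path of representations starting at the trivial one
    gives representations that are close to it on given elements. *)
Lemma small_path_rep (d : R) (g1 g2 : L) (s : seq (L * R)) : 0 < d ->
  fully_residually_free L ->
  exists w : path_rep R L,
    [/\ close d (rep_at w g1 1) 1%g, close d (rep_at w g2 1) 1%g &
        forall g x, (g, x) \in s -> g <> 1%g -> trsq2 (rep_at w g 1) != x].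
Proof.
move=> d0 frL.
have [phi hphi] := @fully_residually_free_path_rep R L [seq q.1 | q <- s] frL.
have cphi g : continuous (path_fun (phi g) \o @clamp R).
  by apply: within_clamp; have [] := based_pathP (phi g).
have near0 g : nbhs (0 : R) [set u | forall r k,
    `|SL2_mx (rep_at phi g (clamp u)) r k - SL2_mx (1%g : SL2 R) r k| < d].
  apply: (@filter_forall _ _ _ (nbhs (0 : R))) => r.
  apply: (@filter_forall _ _ _ (nbhs (0 : R))) => k.
  have : {for 0, continuous (fun u => SL2_mx (rep_at phi g (clamp u)) r k)}.
    exact: (continuous_comp (cphi g 0) (@SL2_coord_continuous R r k _)).
  move/cvgrPdist_lt => /(_ d d0); apply: filterS => u.
  rewrite clamp_id ?lexx ?ler01 // distrC.
  by have [p0 _] := based_pathP (phi g); rewrite {2}/rep_at p0.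
have [e /= e0 he] := (nbhs_ballP _ _).1 (filterI (near0 g1) (near0 g2)).
have em0 : 0 < Num.min e 1 by rewrite lt_min e0 ltr01.
have [|u [u0 ue hu]] := avoid_levels (phi := fun u g => trsq2 (rep_at phi g u)) (s := s) em0.
  move=> q qs q1; have [cq _] := hphi q.1 (map_f _ qs) q1.
  by apply: sub_countable (cq q.2); apply: subset_card_le => v [].
move: ue; rewrite lt_min => /andP[ue u1].
have uI : clamp u = u by rewrite clamp_id // !ltW.
have [c1 c2] : close d (rep_at phi g1 u) 1%g /\ close d (rep_at phi g2 u) 1%g.
  by rewrite -uI; apply: he; rewrite /ball /= sub0r normrN gtr0_norm.
have ok g : is_based_path (fun v => rep_at phi g (clamp (u * v))).
  split.
    rewrite mulr0 clamp_id ?lexx ?ler01 //.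
    by have [p0 _] := based_pathP (phi g); rewrite /rep_at p0.
  apply: continuous_subspaceT => v.
  have cu : continuous (fun v : R => u * v).
    by move=> z; apply: cvgM; [exact: cvg_cst|exact: cvg_id].
  exact: (continuous_comp (cu v) (cphi g _)).
have wM : {morph (fun g => mk_based_path (ok g)) : x y / (x * y)%g}.
  by move=> x y; apply: path_ext => v; exact: rep_atM.
have E g : rep_at (mk_multiplicative wM) g 1 = rep_at phi g u.
  by rewrite /rep_at /= /path_fun /= mulr1 uI.
by exists (mk_multiplicative wM); split; rewrite ?E // => g x; rewrite E; exact: hu.
Qed.

End SmallRepresentations.

(** * Rotations *)

Section Rotations.
Variable R : realType.

Definition rot_mx (t : R) : 'M[R]_2 := mx2 (cos t) (- sin t) (sin t) (cos t).

Lemma rot_det t : \det (rot_mx t) = 1.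
Proof. by rewrite det_mx2 mulNr opprK -!expr2 cos2Dsin2. Qed.

Definition rot (t : R) : SL2 R := insubd (1%g : SL2 R) (rot_mx t).

Lemma rotE t : SL2_mx (rot t) = rot_mx t.
Proof. by rewrite [LHS]val_insubd rot_det eqxx. Qed.

Lemma rotD a b : rot (a + b) = (rot a * rot b)%g.
Proof.
apply: SL2_mx_inj; rewrite SL2_mulE !rotE mul_mx2 /rot_mx cosD sinD.
by congr mx2; ring.
Qed.

Lemma rot0 : rot 0 = 1%g.
Proof.
apply: SL2_mx_inj; rewrite rotE /rot_mx cos0 sin0 oppr0; apply/matrixP => r k.
by rewrite !mxE; case: (ord2P r) => ->; case: (ord2P k) => ->.
Qed.

Lemma rot_rotation t : rotation (rot t).
Proof. by rewrite /rotation rotE !mxE. Qed.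

Lemma rot_trsq2 t : trsq2 (rot t) = 2 + 2 * cos (2 * t).
Proof.
by rewrite /trsq2 rotE tr_mx2 [2 * t]mulr_natl cos_mulr2n; ring.
Qed.

Lemma rot_continuous (T : topologicalType) (f : T -> R) :
  continuous f -> continuous (fun x => rot (f x)).
Proof.
move=> cf; apply: SL2_continuous => r k.
have cc : continuous (fun x => cos (f x)).
  by move=> x; exact: (continuous_comp (cf x) (@continuous_cos R _)).
have cs : continuous (fun x => sin (f x)).
  by move=> x; exact: (continuous_comp (cf x) (@continuous_sin R _)).
rewrite (_ : (fun x => _) = fun x =>
    if r == 0 then (if k == 0 then cos (f x) else - sin (f x))
    else (if k == 0 then sin (f x) else cos (f x))); last first.
  by apply/funext => x; rewrite rotE mxE.
case: (ord2P r) => ->; case: (ord2P k) => -> //=.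
by move=> x; apply: cvgN; exact: cs.
Qed.

Lemma rotation_path_rep (L : groupType) (l : L -> R) :
  {morph l : g h / (g * h)%g >-> g + h} ->
  exists w : path_rep R L, forall g u, rep_at w g u = rot (u * l g).
Proof.
move=> lM.
have ok g : is_based_path (fun u => rot (u * l g)).
  split; first by rewrite mul0r rot0.
  apply: continuous_subspaceT; apply: rot_continuous => u.
  by apply: cvgM; [exact: cvg_id|exact: cvg_cst].
have wM : {morph (fun g => mk_based_path (ok g)) : x y / (x * y)%g}.
  by move=> x y; apply: path_ext => v; rewrite /= /path_fun /= lM mulrDr rotD.
by exists (mk_multiplicative wM).
Qed.

End Rotations.

(** * Characters of abelian groups *)

Section AbelianCharacters.
Variables (R : realType) (L : groupType).

(** In dimension 2 the eigenspaces of a matrix that is not scalar are lines. *)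
Lemma eigenvector_unique (A : 'M[R]_2) (lam : R) (v v' : 'rV[R]_2) :
  A != lam%:M -> v != 0 -> v *m A = lam *: v -> v' *m A = lam *: v' ->
  exists x, v' = x *: v.
Proof.
move=> Al v0 vA v'A.
pose N := A - lam%:M.
have N0 : N != 0 by rewrite subr_eq0.
have vN : v *m N = 0 by rewrite mulmxBr vA mul_mx_scalar subrr.
have v'N : v' *m N = 0 by rewrite mulmxBr v'A mul_mx_scalar subrr.
have rN : (0 < \rank N)%N by rewrite lt0n mxrank_eq0.
have rk : (\rank (kermx N) <= 1)%N by rewrite mxrank_ker; lia.
have vk : (v <= kermx N)%MS by apply/sub_kermxP.
have v'k : (v' <= kermx N)%MS by apply/sub_kermxP.
have rv : \rank v = 1%N by rewrite rank_rV v0.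
have kv : (kermx N <= v)%MS.
  by rewrite -(geq_leqif (mxrank_leqif_sup vk)) rv.
by have /sub_rVP[x ->] := submx_trans v'k kv; exists x.
Qed.

Lemma SL2_eigenvalue (A : SL2 R) (x : R) (v : 'rV[R]_2) : v != 0 ->
  v *m SL2_mx A = x *: v -> x ^+ 2 - \tr (SL2_mx A) * x + 1 = 0.
Proof.
move=> v0 vA.
have : \det (SL2_mx A - x%:M) = 0.
  apply/eqP/det0P; exists v => //.
  by rewrite mulmxBr vA mul_mx_scalar subrr.
have := SL2_det A; rewrite [SL2_mx A]mx2E.
set a := SL2_mx A 0 0; set b := SL2_mx A 0 1; set c := SL2_mx A 1 0; set d := SL2_mx A 1 1.
have -> : mx2 a b c d - x%:M = mx2 (a - x) b c (d - x).
  apply/matrixP => r k; rewrite !mxE.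
  by case: (ord2P r) => ->; case: (ord2P k) => -> /=; rewrite ?mulr1n ?mulr0n ?subr0.
rewrite !det_mx2 tr_mx2 => h1 h2.
by rewrite -[RHS]h2 -h1; ring.
Qed.

Lemma hyperbolic_eigenvector (A : SL2 R) : 4 < trsq2 A ->
  exists (x : R) (v : 'rV[R]_2),
    [/\ v != 0, v *m SL2_mx A = x *: v & SL2_mx A != x%:M].
Proof.
rewrite /trsq2; set t := \tr (SL2_mx A) => t4.
pose x := (t + Num.sqrt (t ^+ 2 - 4)) / 2.
have s2 : Num.sqrt (t ^+ 2 - 4) ^+ 2 = t ^+ 2 - 4 by rewrite sqr_sqrtr //; lra.
have x2 : x ^+ 2 - t * x + 1 = 0 by rewrite /x; nra.
have : \det (SL2_mx A - x%:M) = 0.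
  have := SL2_det A; move: x2; rewrite /t [SL2_mx A]mx2E.
  set a := SL2_mx A 0 0; set b := SL2_mx A 0 1; set c := SL2_mx A 1 0; set d := SL2_mx A 1 1.
  have -> : mx2 a b c d - x%:M = mx2 (a - x) b c (d - x).
    apply/matrixP => r k; rewrite !mxE.
    by case: (ord2P r) => ->; case: (ord2P k) => -> /=; rewrite ?mulr1n ?mulr0n ?subr0.
  rewrite !det_mx2 tr_mx2 => h1 h2.
  by rewrite -[RHS]h1 -h2; ring.
move=> /eqP/det0P[v v0 vA]; exists x, v; split => //.
  by apply/eqP; rewrite -subr_eq0 -mul_mx_scalar -mulmxBr vA.
apply: contraTneq t4 => E; rewrite -leNgt /t E.
have := SL2_det A; rewrite E mxtrace_scalar det_scalar => d.
by rewrite -[x *+ 2]mulr_natl exprMn d expr2; lra.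
Qed.

(** Commuting hyperbolic elements share an eigenvector; the logarithms of their
    eigenvalues on it form a character. *)
Lemma abelian_character (Q : seq L) :
  fully_residually_free L -> (forall g h : L, (g * h = h * g)%g) ->
  exists l : L -> R, {morph l : g h / (g * h)%g >-> g + h} /\
    forall g, g \in Q -> g <> 1%g -> l g != 0.
Proof.
move=> frL ab.
have [phi hphi] := @fully_residually_free_path_rep R L Q frL.
have [[g1 [g1Q g11]]|none] := pselect (exists g, g \in Q /\ g <> 1%g); last first.
  exists (fun=> 0); split => [g h|g gQ g1]; first by rewrite addr0.
  by case: none; exists g.
have [u hu] : exists u, forall g, g \in Q -> g <> 1%g -> 4 < trsq2 (rep_at phi g u).
  have bnd g : exists u0, g \in Q -> g <> 1%g -> forall u, u0 <= u -> 4 < trsq2 (rep_at phi g u).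
    have [[gQ gn]|ng] := pselect (g \in Q /\ g <> 1%g).
      by have [_ [u0 h]] := hphi g gQ gn; exists u0.
    by exists 0 => gQ gn; case: ng.
  have [b hb] := choice bnd; exists (\sum_(g <- Q) `|b g|) => g gQ gn.
  apply: (hb g gQ gn); rewrite (big_rem g) //= (le_trans (ler_norm _)) // lerDl.
  by apply: sumr_ge0.
pose B g := rep_at phi g u.
have BM g h : B (g * h)%g = (B g * B h)%g := rep_atM phi g h u.
have [lam [v [v0 vA Al]]] := hyperbolic_eigenvector (hu g1 g1Q g11).
have hchi g : exists x, v *m SL2_mx (B g) = x *: v.
  apply: (eigenvector_unique Al v0 vA).
  rewrite -mulmxA -[SL2_mx (B g) *m _]SL2_mulE -BM ab BM SL2_mulE mulmxA vA.
  by rewrite scalemxAl.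
have [chi {}hchi] := choice hchi.
have vI x y : x *: v = y *: v -> x = y.
  move/eqP; rewrite -subr_eq0 -scalerBl scaler_eq0 (negPf v0) orbF subr_eq0.
  by move/eqP.
have chiM g h : chi (g * h)%g = chi g * chi h.
  by apply: vI; rewrite -hchi BM SL2_mulE mulmxA hchi -scalemxAl hchi scalerA.
have chi0 g : chi g != 0.
  apply: contra_neq v0 => c0; have := hchi g; rewrite c0 scale0r => h.
  by rewrite -[v](mulmxK (SL2_unit (B g))) h mul0mx.
exists (fun g => ln `|chi g|); split.
  by move=> g h; rewrite chiM normrM lnM // posrE normr_gt0.
move=> g gQ gn; apply/negP => /eqP ln0.
have n1 : `|chi g| = 1.
  by apply: ln_inj; rewrite ?posrE ?normr_gt0 ?ltr01 // ln0 ln1.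
have := SL2_eigenvalue v0 (hchi g).
have := hu g gQ gn; rewrite /trsq2 -/(B g).
have : chi g ^+ 2 = 1 by rewrite -[LHS]ger0_norm ?sqr_ge0 // normrX n1 expr1n.
set t := \tr _; set x := chi g; move=> x2 t4 e.
have tx : t * x = 2 by lra.
have : (t * x) ^+ 2 = t ^+ 2 by rewrite exprMn x2 mulr1.
by rewrite tx expr2; lra.
Qed.

(** Rotating by small multiples of a character gives indiscrete representations of
    abelian groups, even of cyclic ones. *)
Lemma rotation_path_rep_avoiding (s : seq (L * R)) :
  fully_residually_free L -> (forall g h : L, (g * h = h * g)%g) ->
  exists w : path_rep R L, (forall g, rotation (rep_at w g 1)) /\
    forall g x, (g, x) \in s -> g <> 1%g -> trsq2 (rep_at w g 1) != x.
Proof.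
move=> frL ab.
have [l [lM l0]] := abelian_character [seq q.1 | q <- s] frL ab.
(* For [k < pi / (2 M)] all the angles [2 k l q] stay in the interval where the
   cosine is injective, so each condition excludes at most one [k]. *)
pose M := \sum_(q <- s) `|l q.1| + 1.
have M0 : 0 < M by rewrite ltr_wpDl // sumr_ge0.
have lM' q : q \in s -> `|l q.1| <= M.
  move=> qs; rewrite /M (big_rem q) //= -addrA lerDl addr_ge0 // sumr_ge0 //.
have e0 : 0 < pi / (2 * M) by rewrite divr_gt0 ?pi_gt0 ?mulr_gt0.
have [|k [k0 ke hk]] := avoid_levels (L := L)
    (phi := fun k g => trsq2 (rot (k * l g))) (s := s) e0.
  move=> q qs q1; have lq := l0 q.1 (map_f _ qs) q1.
  have cosE c : cos (2 * (c * l q.1)) = cos (2 * (c * `|l q.1|)).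
    by case: (ler0P (l q.1)) => // _; rewrite !mulrN cosN.
  have inI c : 0 < c < pi / (2 * M) -> 2 * (c * `|l q.1|) \in `[0, pi].
    move=> /andP[c0 c1]; rewrite in_itv /= !mulr_ge0 ?(ltW c0) //=.
    have cM : c * (2 * M) <= pi by rewrite -ler_pdivlMr ?mulr_gt0 // ltW.
    rewrite (le_trans _ cM) // mulrCA ler_pM2l // ler_pM2l //; exact: lM'.
  have inj a b : 0 < a < pi / (2 * M) -> 0 < b < pi / (2 * M) ->
      trsq2 (rot (a * l q.1)) = trsq2 (rot (b * l q.1)) -> a = b.
    move=> ha hb; rewrite !rot_trsq2 !cosE => h.
    have {}h : cos (2 * (a * `|l q.1|)) = cos (2 * (b * `|l q.1|)) by lra.
    have := cos_inj (inI a ha) (inI b hb) h.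
    move/mulfI; rewrite pnatr_eq0 => /(_ isT) /mulIf; apply.
    by rewrite normr_eq0.
  have [[a [ha aq]]|none] := pselect
      (exists u, 0 < u < pi / (2 * M) /\ trsq2 (rot (u * l q.1)) = q.2).
    apply: sub_countable (countable1 a); apply: subset_card_le => b /= [hb bq].
    by apply: inj; rewrite // aq bq.
  apply: sub_countable (countable0 R); apply: subset_card_le => b hb.
  by case: none; exists b.
have [|w hw] := @rotation_path_rep R L (fun g => k * l g).
  by move=> g h; rewrite lM mulrDr.
exists w; split=> [g|g x gx g1]; rewrite hw mul1r; first exact: rot_rotation.
exact: hk.
Qed.

End AbelianCharacters.

(** * Commutation and commutators near 1 *)

Section SL2Algebra.
Variable R : realType.
Implicit Types A B C : SL2 R.

Lemma SL2_mxP A : exists a b c d, SL2_mx A = mx2 a b c d /\ a * d - b * c = 1.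
Proof.
exists (SL2_mx A 0 0), (SL2_mx A 0 1), (SL2_mx A 1 0), (SL2_mx A 1 1).
by rewrite -det_mx2 -mx2E SL2_det.
Qed.

Lemma mx2_inj a b c d a' b' c' d' : mx2 a b c d = mx2 a' b' c' d' :> 'M[R]_2 ->
  [/\ a = a', b = b', c = c' & d = d'].
Proof.
move=> /matrixP E; have := E 0 0; have := E 0 1; have := E 1 0; have := E 1 1.
by rewrite !mxE.
Qed.

Lemma SL2_inv_mx2 A a b c d : SL2_mx A = mx2 a b c d -> a * d - b * c = 1 ->
  SL2_mx A^-1%g = mx2 d (- b) (- c) a.
Proof.
move=> E dE; have : SL2_mx A^-1%g *m SL2_mx A = 1%:M by rewrite -SL2_mulE mulVg.
rewrite E => /(congr1 (mulmx^~ (mx2 d (- b) (- c) a))).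
rewrite -mulmxA mul1mx mul_mx2 => <-.
rewrite (_ : mx2 _ _ _ _ = 1%:M) ?mulmx1 //; apply/matrixP => r k; rewrite !mxE.
by case: (ord2P r) => ->; case: (ord2P k) => -> /=; rewrite -?dE; ring.
Qed.

Lemma SL2_addV A : SL2_mx A + SL2_mx A^-1%g = (\tr (SL2_mx A))%:M.
Proof.
have [a [b [c [d [EA dA]]]]] := SL2_mxP A.
rewrite (SL2_inv_mx2 EA dA) EA tr_mx2; apply/matrixP => r k; rewrite !mxE.
by case: (ord2P r) => ->; case: (ord2P k) => -> /=;
  rewrite ?mulr1n ?mulr0n ?subrr // addrC.
Qed.

Lemma SL2_det_sub A C : \det (SL2_mx C - SL2_mx A) + \det (SL2_mx C - SL2_mx A^-1%g)
  = 4 - \tr (SL2_mx A) * \tr (SL2_mx C).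
Proof.
have [a [b [c [d [EA dA]]]]] := SL2_mxP A.
have [p [q [r [s [EC dC]]]]] := SL2_mxP C.
have subE a1 b1 c1 d1 a2 b2 c2 d2 : mx2 a1 b1 c1 d1 - mx2 a2 b2 c2 d2 =
    mx2 (a1 - a2) (b1 - b2) (c1 - c2) (d1 - d2) :> 'M[R]_2.
  apply/matrixP => x y; rewrite !mxE.
  by case: (ord2P x) => ->; case: (ord2P y) => ->.
rewrite (SL2_inv_mx2 EA dA) EA EC !subE !det_mx2 !tr_mx2.
rewrite (_ : 4 = 2 * (a * d - b * c) + 2 * (p * s - q * r)); first by ring.
by rewrite dA dC; ring.
Qed.

(** The product of [C - A] and [C - A^-1] vanishes, and the sum of their
    determinants is [4 - trsq2 A], so one of them is invertible. *)
Lemma commute_conj A C : commute A C ->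
  \tr (SL2_mx A) = \tr (SL2_mx C) -> trsq2 A != 4 -> C = A \/ C = A^-1%g.
Proof.
move=> cA t A4.
(* Both [C] and its inverse have the trace of [A], so this is the characteristic
   equation of [C]. *)
have MN : (SL2_mx C - SL2_mx A) *m (SL2_mx C - SL2_mx A^-1%g) = 0.
  rewrite mulmxBl !mulmxBr -!SL2_mulE mulgV -(mulgV C) cA !SL2_mulE.
  rewrite opprB addrACA -opprD -!mulmxDr [_ + SL2_mx A]addrC.
  by rewrite !SL2_addV -t subrr.
have [dM|dM] := eqVneq (\det (SL2_mx C - SL2_mx A)) 0; last first.
  right; apply: SL2_mx_inj; apply/eqP; rewrite -subr_eq0; apply/eqP.
  have uM : SL2_mx C - SL2_mx A \in unitmx by rewrite unitmxE unitfE.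
  by rewrite -[LHS](mulKmx uM) MN mulmx0.
have [dN|dN] := eqVneq (\det (SL2_mx C - SL2_mx A^-1%g)) 0; last first.
  left; apply: SL2_mx_inj; apply/eqP; rewrite -subr_eq0; apply/eqP.
  have uN : SL2_mx C - SL2_mx A^-1%g \in unitmx by rewrite unitmxE unitfE.
  by rewrite -[LHS](mulmxK uN) MN mul0mx.
case/eqP: A4; have := SL2_det_sub A C; rewrite dM dN /trsq2 -t expr2; lra.
Qed.

(** An element conjugating [A] to its inverse exchanges the eigenlines of [A]. *)
Lemma conj_inv_trace A B : (B * A)%g = (A^-1 * B)%g -> trsq2 A != 4 ->
  \tr (SL2_mx B) = 0.
Proof.
have [a [b [c [d [EA dA]]]]] := SL2_mxP A.
have [p [q [r [s [EB dB]]]]] := SL2_mxP B.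
move=> /(congr1 (@SL2_mx R)); rewrite !SL2_mulE (SL2_inv_mx2 EA dA).
rewrite /trsq2 EA EB !mul_mx2 !tr_mx2 => /mx2_inj[e1 e2 e3 e4] t4.
apply/eqP; apply: contraNT t4 => ps0.
have b0 : b = 0 by apply: (mulIf ps0); lra.
have c0 : c = 0 by apply: (mulIf ps0); lra.
have ad : a = d by apply: (mulIf ps0); lra.
by move: dA; rewrite b0 c0 ad => h; apply/eqP; lra.
Qed.

Lemma commute_of_commute_conj A B : trsq2 A != 4 -> trsq2 B != 0 ->
  commute A (B * A * B^-1)%g -> commute A B.
Proof.
move=> A4 B0 cA.
have trC : \tr (SL2_mx A) = \tr (SL2_mx (B * A * B^-1)%g).
  by rewrite SL2_mulE mxtrace_mulC -SL2_mulE mulKg.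
have [E|E] := commute_conj cA trC A4.
  by rewrite /commute -[in LHS]E mulgVK.
case/eqP: B0; rewrite /trsq2 (@conj_inv_trace A B) ?expr0n //.
by rewrite -E mulgVK.
Qed.

End SL2Algebra.

Section Commutators.
Variable R : realType.
Implicit Types A B : SL2 R.

Definition mx_bound (e : R) (M : 'M[R]_2) := forall r k, `|M r k| <= e.

Lemma mx_bound_mul a b (M N : 'M[R]_2) : 0 <= a ->
  mx_bound a M -> mx_bound b N -> mx_bound (2 * (a * b)) (M *m N).
Proof.
move=> a0 hM hN r k; rewrite mxE big_ord_recl big_ord1 (le_trans (ler_normD _ _)) //.
by rewrite !normrM mulr_natl mulr2n lerD // ler_pM.
Qed.

Lemma mx_bound_sub a b (M N : 'M[R]_2) :
  mx_bound a M -> mx_bound b N -> mx_bound (a + b) (M - N).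
Proof.
by move=> hM hN r k; rewrite !mxE (le_trans (ler_normB _ _)) // lerD.
Qed.

Lemma mx_bound_inv e A : e <= 1 -> mx_bound e (SL2_mx A - 1%:M) ->
  mx_bound 2 (SL2_mx A^-1%g).
Proof.
move=> e1 hA; have [a [b [c [d [EA dA]]]]] := SL2_mxP A.
rewrite (SL2_inv_mx2 EA dA) => r k; rewrite mxE.
have := hA 0 0; have := hA 0 1; have := hA 1 0; have := hA 1 1.
rewrite EA !mxE /= ?mulr1n ?mulr0n ?subr0.
rewrite !ler_norml => /andP[? ?] /andP[? ?] /andP[? ?] /andP[? ?].
by case: (ord2P r) => ->; case: (ord2P k) => -> /=; apply/andP; split; lra.
Qed.

(** The commutator minus 1 is the additive commutator of [A - 1] and [B - 1] times
    a bounded matrix, so it is of the order of the product of their sizes; the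
    constant 128 absorbs the bounds on the inverses. *)
Lemma commutator_bound A B e : e <= 1 -> mx_bound (128^-1) (SL2_mx A - 1%:M) ->
  mx_bound e (SL2_mx B - 1%:M) ->
  mx_bound (e / 2) (SL2_mx (A * B * A^-1 * B^-1)%g - 1%:M).
Proof.
move=> e1 hA hB.
have e0 : 0 <= e by rewrite (le_trans _ (hB 0 0)).
have -> : SL2_mx (A * B * A^-1 * B^-1)%g - 1%:M =
    ((SL2_mx A - 1%:M) *m (SL2_mx B - 1%:M) - (SL2_mx B - 1%:M) *m (SL2_mx A - 1%:M))
    *m SL2_mx A^-1%g *m SL2_mx B^-1%g.
  rewrite !mulmxBl !mulmxBr !mulmx1 !mul1mx -!SL2_mulE.
  have -> : (1 : R)%:M = SL2_mx (B * A * A^-1 * B^-1)%g.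
    by rewrite mulgK mulgV.
  rewrite !SL2_mulE -!mulmxBl; congr (_ *m _ *m _).
  by rewrite !opprD !opprK; apply/matrixP => r k; rewrite !mxE; ring.
have hAi := mx_bound_inv (e := 128^-1) _ hA.
have hBi := mx_bound_inv e1 hB.
have h1 := mx_bound_sub (mx_bound_mul _ hA hB) (mx_bound_mul e0 hB hA).
have h2 := mx_bound_mul _ (mx_bound_mul _ (h1 _) (hAi _)) hBi.
move=> r k; rewrite (le_trans (h2 _ _ _ _ r k)) //; try lra.
all: by rewrite ?invr_ge0 ?addr_ge0 ?mulr_ge0 ?invr_ge0 //.
Qed.

End Commutators.

(** * Projective representations and indiscreteness *)

Section ProjectiveRepresentations.
Local Open Scope quotient_scope.
Variables (R : realType) (L : groupType).
Implicit Types w : path_rep R L.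

Lemma PSL2_path_based w g :
  is_based_path (fun u => PSL2_pi (rep_at w g u)).
Proof.
have [w0 cw] := based_pathP (w g).
split; first by rewrite /rep_at w0 (mult_one (@PSL2_pi R)).
apply: within_continuous_comp => // A _; exact: PSL2_pi_continuous.
Qed.

Lemma PSL2_pathM w :
  {morph (fun g => mk_based_path (PSL2_path_based w g)) : g h / (g * h)%g}.
Proof.
move=> g h; apply: path_ext => u.
rewrite -[LHS]/(PSL2_pi (rep_at w (g * h)%g u)) rep_atM; exact: PSL2_piM.
Qed.

Lemma path_rep_projM w : {morph (fun g => PSL2_pi (rep_at w g 1)) : g h / (g * h)%g}.
Proof. by move=> g h; rewrite rep_atM; exact: PSL2_piM. Qed.

Definition path_rep_proj w : {multiplicative L -> PSL2 R} :=
  mk_multiplicative (@path_rep_projM w).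

Lemma path_rep_projE w g : path_rep_proj w g = PSL2_pi (rep_at w g 1).
Proof. by []. Qed.

Lemma trsq_proj w g : trsq (path_rep_proj w g) = trsq2 (rep_at w g 1).
Proof. exact: trsq_pi. Qed.

(** The path itself is the lift. *)
Lemma path_rep_liftable w : liftable (path_rep_proj w).
Proof.
pose lift g : universal_cover R (PSL2 R) :=
  \pi_(universal_cover R (PSL2 R)) (mk_based_path (PSL2_path_based w g)).
have lM : {morph lift : g h / (g * h)%g}.
  by move=> g h; rewrite /lift PSL2_pathM; exact: Defs.pi_mul.
exists (mk_multiplicative lM) => g.
by rewrite -[RHS]/(covering_map (lift g)) covering_map_pi.
Qed.

Section Faithful.
Variable w : path_rep R L.
Hypothesis w4 : forall g : L, g <> 1%g -> trsq2 (rep_at w g 1) != 4.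

Lemma path_rep_faithful : faithful (path_rep_proj w).
Proof.
move=> g h gh; apply: contrapT => ngh.
have n1 : (g * h^-1)%g <> 1%g by move=> E; apply: ngh; apply: (mulIg h^-1%g); rewrite E mulgV.
have /eqP := w4 n1; apply; rewrite -trsq_proj gmulfM gh -gmulfM mulgV.
rewrite trsq_proj rep_at1 /trsq2 SL2_1E mxtrace1 expr2; lra.
Qed.

Lemma path_rep_parabolic_free : parabolic_free (path_rep_proj w).
Proof.
move=> _ [g _ <-]; rewrite /parabolic trsq_proj => E.
have [->|/eqP g1] := eqVneq g 1%g; first exact: mult_one.
by have /eqP := w4 g1.
Qed.

Lemma nbhs1_close (V : set (SL2 R)) : nbhs (1%g : SL2 R) V ->
  exists2 d, 0 < d & forall A, mx_bound d (SL2_mx A - 1%:M) -> V A.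
Proof.
rewrite nbhsE => -[O [[P oP PO] O1] OV].
have : nbhs (SL2_mx (1%g : SL2 R)) P.
  by apply: open_nbhs_nbhs; split => //; move: O1; rewrite -PO.
move=> /nbhs_ballP[e /= e0 he]; exists (e / 2); first by rewrite divr_gt0.
move=> A hA; apply: OV; rewrite -PO; apply: he; split => // r k.
have := hA r k; rewrite !mxE /ball /= distrC => h; rewrite (le_lt_trans h) //.
by rewrite ltr_pdivrMr // ltr_pMr // ltr1n.
Qed.

Lemma path_rep_indiscrete :
  (forall d, 0 < d -> exists2 g : L, g <> 1%g & mx_bound d (SL2_mx (rep_at w g 1) - 1%:M)) ->
  indiscrete (path_rep_proj w).
Proof.
move=> small dis.
have E1 : path_rep_proj w 1%g = 1%g by exact: mult_one.
have r1 : range (path_rep_proj w) 1%g by exists 1%g.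
have [_ [V nV VE]] := dis _ r1.
have nV' : nbhs (1%g : SL2 R) (@PSL2_pi R @^-1` V).
  apply: (@PSL2_pi_continuous R 1%g V).
  by rewrite (mult_one (@PSL2_pi R)).
have [d d0 hd] := nbhs1_close nV'.
have [g g1 hg] := small d d0; apply: g1; apply: path_rep_faithful.
rewrite E1; have : (V `&` range (path_rep_proj w)) (path_rep_proj w g).
  by split; [exact: hd|exists g].
by rewrite VE.
Qed.

End Faithful.

(** Iterated commutators of two noncommuting elements close to 1 converge to 1
    without ever reaching it. *)
Lemma noncommuting_indiscrete w (g h : L) :
  (forall k : L, k <> 1%g -> trsq2 (rep_at w k 1) != 4) ->
  (forall k : L, k <> 1%g -> trsq2 (rep_at w k 1) != 0) ->
  mx_bound (128^-1) (SL2_mx (rep_at w g 1) - 1%:M) ->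
  mx_bound (128^-1) (SL2_mx (rep_at w h 1) - 1%:M) ->
  ~ commute g h -> indiscrete (path_rep_proj w).
Proof.
move=> w4 w0 gb hb ngh; apply: path_rep_indiscrete => // d d0.
pose b := fix b n : L := if n is n'.+1 then (g * b n' * g^-1 * (b n')^-1)%g else h.
have sigma_inj k l : rep_at w k 1 = rep_at w l 1 -> k = l.
  by move=> E; apply: (path_rep_faithful w4); rewrite !path_rep_projE E.
have ncom n : ~ commute g (b n).
  elim: n => [//|n IH] /= c; apply: IH.
  have g1 : g <> 1%g by move=> g1; apply: ngh; rewrite g1 /commute mul1g mulg1.
  have [->|/eqP bn1] := eqVneq (b n) 1%g; first exact: commute1.
  have cg : commute g (b n * g * (b n)^-1)%g.
    set x := (g * b n * g^-1 * (b n)^-1)%g in c.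
    have -> : (b n * g * (b n)^-1 = x^-1 * g)%g.
      by rewrite /x !invgM !invgK !mulgA mulgVK.
    by apply: commuteM; [exact: commuteV|exact: commute_refl].
  apply: sigma_inj; rewrite !rep_atM.
  rewrite -/(commute (rep_at w g 1) (rep_at w (b n) 1)).
  apply: (commute_of_commute_conj (w4 g g1) (w0 _ bn1)).
  by rewrite /commute -rep_atV -!rep_atM cg.
have bnd n : mx_bound (128^-1 / 2 ^+ n) (SL2_mx (rep_at w (b n) 1) - 1%:M).
  elim: n => [|n IH]; first by rewrite expr0 divr1.
  rewrite exprS invfM mulrCA mulrC /= !rep_atM !rep_atV.
  apply: commutator_bound => //.
  rewrite ler_pdivrMr ?exprn_gt0 // mul1r (le_trans (_ : _ <= 1)) //; first by lra.
  by rewrite exprn_ege1 // ler1n.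
pose n := Num.bound d^-1.
exists (b n) => [b1|]; first by apply: (ncom n); rewrite b1; exact: commute1.
move=> r k; rewrite (le_trans (bnd n r k)) //.
have : d^-1 < 2 ^+ n by apply: upper_nthrootP.
rewrite invf_plt ?posrE ?exprn_gt0 // => dn.
by rewrite (le_trans _ (ltW dn)) // ler_piMl ?invr_ge0 ?exprn_ge0 //; lra.
Qed.

(** The powers of an element of infinite order in the compact group of rotations
    accumulate. *)
Lemma rotation_indiscrete w (g : L) :
  (forall k : L, k <> 1%g -> trsq2 (rep_at w k 1) != 4) ->
  (forall k, rotation (rep_at w k 1)) ->
  (forall n, (0 < n)%N -> (g ^+ n)%g <> 1%g) -> indiscrete (path_rep_proj w).
Proof.
move=> w4 rw tf; apply: path_rep_indiscrete => // d d0.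
pose A n := SL2_mx (rep_at w (g ^+ n)%g 1).
have rotA k : mx_bound 1 (SL2_mx (rep_at w k 1)).
  have [a [b [c [e [E dE]]]]] := SL2_mxP (rep_at w k 1).
  have := rw k; rewrite /rotation E !mxE /= => -[ae bc].
  have ac : e ^+ 2 + c ^+ 2 = 1 by rewrite -dE ae bc; ring.
  have e1 : `|e| <= 1 by rewrite ler_norml; apply/andP; split; nra.
  have c1 : `|c| <= 1 by rewrite ler_norml; apply/andP; split; nra.
  move=> r s; rewrite mxE.
  by case: (ord2P r) => ->; case: (ord2P s) => -> /=; rewrite ?ae ?bc ?normrN.
have [p [_ clp]] : (`[-1, 1] `*` `[-1, 1]) `&` cluster ((fun n => (A n 0 0, A n 1 0)) @ \oo) !=set0.
  apply: (compact_setX (@segment_compact R (-1) 1) (@segment_compact R (-1) 1)).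
  exists 0%N => // n _; split; rewrite /= in_itv /= -ler_norml.
    exact: (rotA (g ^+ n)%g 0 0).
  exact: (rotA (g ^+ n)%g 1 0).
have near_p N : exists2 n, (N <= n)%N & `|A n 0 0 - p.1| < d / 4 /\ `|A n 1 0 - p.2| < d / 4.
  have nb : nbhs p [set q : R * R | `|q.1 - p.1| < d / 4 /\ `|q.2 - p.2| < d / 4].
    exists (ball p.1 (d / 4), ball p.2 (d / 4)).
      by split; apply: nbhsx_ballx; rewrite divr_gt0.
    by move=> [x y] /= [h1 h2]; split; rewrite distrC.
  have nN : ((fun n => (A n 0 0, A n 1 0)) @ \oo)
      [set (A n 0 0, A n 1 0) | n in [set n | (N <= n)%N]].
    by exists N => // n /= hn; exists n.
  by have [_ [[n hn <-] [h1 h2]]] := clp _ _ nN nb; exists n.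
have [n _ [n1 n2]] := near_p 0%N; have [m nm [m1 m2]] := near_p n.+1.
exists (g ^+ (m - n))%g; first by apply: tf; rewrite subn_gt0.
have E : SL2_mx (rep_at w (g ^+ (m - n))%g 1) - 1%:M =
    (A m - A n) *m SL2_mx (rep_at w (g ^+ n)^-1%g 1).
  rewrite mulmxBl /A -!SL2_mulE -!rep_atM mulgV rep_at1.
  by rewrite -{2}(subnK (ltnW nm)) expgnDr mulgK.
have hAB : mx_bound (d / 2) (A m - A n).
  have h0 : `|A m 0 0 - A n 0 0| <= d / 2.
    move: m1 n1; rewrite !ltr_norml ler_norml => /andP[? ?] /andP[? ?].
    by apply/andP; split; lra.
  have h1 : `|A m 1 0 - A n 1 0| <= d / 2.
    move: m2 n2; rewrite !ltr_norml ler_norml => /andP[? ?] /andP[? ?].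
    by apply/andP; split; lra.
  have [rm1 rm2] := rw (g ^+ m)%g; have [rn1 rn2] := rw (g ^+ n)%g.
  move=> r s; rewrite !mxE.
  case: (ord2P r) => ->; case: (ord2P s) => -> //.
    by rewrite /A rm2 rn2 opprK addrC distrC.
  by rewrite /A -rm1 -rn1.
rewrite E => r s.
have := mx_bound_mul _ hAB (rotA (g ^+ n)^-1%g) r s.
rewrite (_ : 2 * (d / 2 * 1) = d); last by lra.
apply.
by rewrite divr_ge0 // ltW.
Qed.

End ProjectiveRepresentations.

(** * Uncountable tracially disjoint families *)

(** The ultrafilter with respect to which every element of [T] eventually
    belongs to a finite sequence. *)
Lemma ultrafilter_of_finite (T : eqType) : exists U : set_system (seq T),
  UltraFilter U /\ forall t : T, U [set s : seq T | t \in s].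
Proof.
pose F : set_system (seq T) := [set A : set (seq T) | exists s0 : seq T,
  forall s : seq T, {subset s0 <= s} -> A s].
have FF : ProperFilter F.
  apply: Build_ProperFilter_ex.
    by move=> A [s0 h]; exists s0; exact: h.
  split.
  - by exists [::].
  - move=> A B [s1 h1] [s2 h2]; exists (s1 ++ s2) => s hs.
    by split; [apply: h1|apply: h2] => t ts; apply: hs; rewrite mem_cat ts ?orbT.
  - by move=> A B AB [s0 h]; exists s0 => s /h /AB.
have [U [UU FU]] := ultraFilterLemma FF.
exists U; split => // t; apply: FU; exists [:: t] => s; apply; exact: mem_head.
Qed.

Section GenericRepresentation.
Variables (R : realType) (L : groupType).
Hypothesis limL : limit_group L.

(** A countable set of values of the squared trace can be avoided by a
    deformation as soon as every finite part of it can. *)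
Lemma avoiding_deformation (P : path_rep R L -> Prop) (X : set R) :
  countable X ->
  (forall s : seq (L * R), exists2 w, P w &
     forall g x, (g, x) \in s -> g <> 1%g -> trsq2 (rep_at w g 1) != x) ->
  forall d g1 g2, 0 < d -> exists w rho : path_rep R L,
    [/\ P w, forall g x, g <> 1%g -> X x -> trsq2 (rep_at rho g 1) != x,
        close d (rep_at rho g1 1) (rep_at w g1 1),
        close d (rep_at rho g2 1) (rep_at w g2 1) &
        (forall w, P w -> forall g, rotation (rep_at w g 1)) ->
        forall g, rotation (rep_at rho g 1)].
Proof.
case: limL => fgL _ cX hs d g1 g2 d0.
have [U [UU Umem]] := ultrafilter_of_finite (L * R)%type.
have hs' (s : seq (L * R)) : exists w, P w /\ forall g x, (g, x) \in s -> g <> 1%g ->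
    trsq2 (rep_at w g 1) != x.
  by have [w Pw h] := hs s; exists w.
have [w hw] := choice hs'.
have cY : countable ([set g | g <> 1%g] `*` X : set (L * R)).
  apply: countableX => //; apply: sub_countable (finitely_generated_countable fgL).
  exact: subset_card_le.
have [|i hi] := deformation fgL UU (w := w) cY.
  move=> g x [/= g1' Xx]; apply: filterS (Umem (g, x)) => s /= gs.
  exact: (hw s).2.
have [rho [avoid c1 c2 rotr]] := hi d g1 g2 d0.
exists (w i), rho; split => //.
- exact: (hw i).1.
- by move=> g x gn Xx; exact: avoid.
- by move=> Prot g; apply: rotr => j; apply: Prot; exact: (hw j).1.
Qed.

(** A nonabelian group is represented near 1 and an abelian one by rotations; both
    properties survive a small deformation and entail indiscreteness. *)
Lemma exists_indiscrete_avoiding (X : set R) :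
  (exists x : L, x <> 1%g) -> countable X -> X 4 -> X 0 ->
  exists w : path_rep R L, indiscrete (path_rep_proj w) /\
    forall g x, g <> 1%g -> X x -> trsq2 (rep_at w g 1) != x.
Proof.
move=> [k k1] cX X4 X0; have frL := limL.2.
have [ab|/existsNP[g /existsNP[h ngh]]] := pselect (forall g h : L, commute g h).
  have [|_ [w [_ avoid _ _ rotw]]] := @avoiding_deformation
      (fun w => forall g, rotation (rep_at w g 1)) X cX _ 1 1%g 1%g ltr01.
    by move=> s; have [w [rw hw]] := rotation_path_rep_avoiding s frL ab; exists w.
  exists w; split => //.
  apply: (@rotation_indiscrete R L w k) => [g g1|g|n n0 kn].
  - exact: avoid.
  - exact: rotw.
  - have [l [lM l0]] := @abelian_character R L [:: k] frL ab.
    have lX m : l (k ^+ m)%g = l k *+ m.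
      elim: m => [|m IH]; last by rewrite expgS lM IH mulrS.
      have := lM 1%g 1%g; rewrite mulg1 mulr0n -[X in X = _ -> _]addr0.
      by move/addrI => /esym.
    have := lX n; rewrite kn -(expg0 k) lX mulr0n => /esym/eqP.
    by rewrite mulrn_eq0 (negPf (l0 k _ k1)) ?inE ?eqxx // orbF eqn0Ngt n0.
have d0 : 0 < 256^-1 :> R by rewrite invr_gt0.
have [|w' [w [[c1 c2] avoid e1 e2 _]]] := @avoiding_deformation
    (fun w => close 256^-1 (rep_at w g 1) 1%g /\ close 256^-1 (rep_at w h 1) 1%g)
    X cX _ _ g h d0.
  by move=> s; have [w [c1 c2 hw]] := @small_path_rep R L _ g h s d0 frL; exists w.
have near (A B : SL2 R) : close 256^-1 A B -> close 256^-1 B 1%g ->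
    mx_bound 128^-1 (SL2_mx A - 1%:M).
  move=> hA hB r s; have := hA r s; have := hB r s.
  rewrite SL2_1E !mxE !ltr_norml ler_norml.
  by move=> /andP[? ?] /andP[? ?]; apply/andP; split; lra.
exists w; split => //.
apply: (noncommuting_indiscrete _ _ (near _ _ e1 c1) (near _ _ e2 c2) ngh).
  by move=> m m1; exact: avoid.
by move=> m m1; exact: avoid.
Qed.

End GenericRepresentation.

Theorem corollary1p7 (R : realType) (L : groupType) :
  limit_group L -> (exists x : L, x <> 1%g) -> liftable_flexible R L.
Proof.
move=> limL nt; split; first exact: limL.1.
pose good (rho : {multiplicative L -> PSL2 R}) :=
  [/\ indiscrete rho, faithful rho, parabolic_free rho & liftable rho].
pose P (Lam : set {multiplicative L -> PSL2 R}) :=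
  tracially_disjoint Lam /\ forall rho, Lam rho -> good rho.
(* A maximal family cannot be countable: the values of its squared traces could
   be avoided by one more representation. *)
have [|Lam [[dis gLam] maxL]] := @Zorn_bigcup _ P.
  move=> F FP totF; split; last by move=> rho [A FA Arho]; exact: (FP A FA).2.
  move=> rho lam [A FA Ar] [B FB Bl]; have [AB|BA] := totF A B FA FB.
    by apply: (FP B FB).1 => //; exact: AB.
  by apply: (FP A FA).1 => //; exact: BA.
exists Lam; split => // cLam.
pose X : set R := (\bigcup_(rho in Lam) ((fun g => trsq (rho g)) @` [set: L]))
  `|` [set x | x \in [:: 0; 4]].
have cX : countable X.
  rewrite /X -bigcup2E.
  apply: bigcup_countable => // -[|[|n]] _ /=; last exact: countable0.
    apply: bigcup_countable => // rho _.
    apply: card_le_trans (card_image_le _ _) _.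
    exact: finitely_generated_countable limL.1.
  exact/finite_set_countable/finite_seq.
have X0 : X 0 by right; rewrite /= inE eqxx.
have X4 : X 4 by right; rewrite /= !inE eqxx orbT.
have [w [iw avoid]] := exists_indiscrete_avoiding limL nt cX X4 X0.
have w4 g : g <> 1%g -> trsq2 (rep_at w g 1) != 4 by move=> g1; exact: avoid.
have avoidL lam g h : Lam lam -> g <> 1%g -> trsq (path_rep_proj w g) <> trsq (lam h).
  move=> Ll g1 E; have Xh : X (trsq (lam h)) by left; exists lam => //; exists h.
  by have := avoid g _ g1 Xh; rewrite -E trsq_proj eqxx.
have tor1 g : (~` torsion L) g -> g <> 1%g.
  by move=> ng g1; apply: ng; exists 1%N; rewrite g1.
apply: (maxL (Lam `|` [set path_rep_proj w])).
  split=> [rho|/(_ (path_rep_proj w) (or_intror erefl)) Lw]; first by left.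
  by have [k k1] := nt; exact: (avoidL _ k k Lw k1).
split; last first.
  move=> rho [|->]; first exact: gLam.
  split => //; [exact: path_rep_faithful|exact: path_rep_parabolic_free|exact: path_rep_liftable].
move=> rho lam [Lr|->] [Ll|->] neq //; first exact: dis.
- apply/seteqP; split => // x [[g _ <-] [h /tor1 h1 E]].
  exact: (avoidL _ _ g Lr h1 E).
- apply/seteqP; split => // x [[g /tor1 g1 <-] [h _ E]].
  exact: (avoidL _ _ h Ll g1 (esym E)).
Qed.
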